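(* There are universal constants $C,c,d,c',d'>0$ such that the following holds. Let $\mathcal X$ be a Hilbert space, let $(T_\nu)_{\nu\in\Lambda}$, $|\Lambda|=B<\infty$, be a real orthonormal system on a set $\mathcal U$ with orthogonalization probability measure $\eta$, and let $\omega=(\omega_\nu)_{\nu\in\Lambda}$ with $\omega_\nu\ge\|T_\nu\|_\infty$. Let $s\ge2\|\omega\|_\infty^2$, $\gamma\in(0,1)$, and $$m\ge Cs\max\{\log^3(s)\log(B),\log(\gamma^{-1})\}.$$ Draw $y^{(1)},\dots,y^{(m)}$ independently from $\eta$ and let $A\in\mathbb R^{m\times\Lambda}$, $A_{i,\nu}=T_\nu(y^{(i)})$. Then with probability at least $1-\gamma$ the following holds for every $f=\sum_{\nu\in\Lambda}f_\nu T_\nu$ with $f_\nu\in\mathcal X$ and every $\varepsilon\ge0$: if $b^{(1)},\dots,b^{(m)}\in\mathcal X$ satisfy $\|b^{(i)}-f(y^{(i)})\|_{\mathcal X}\le\varepsilon$ for all $i$, and $\widetilde F=(\widetilde F_\nu)_{\nu\in\Lambda}\in\mathcal X^\Lambda$ is a solution of $$\min_{z\in\mathcal X^\Lambda}\|z\|_{\mathcal X,1}^{(\omega)}\quad\text{s.t. }\Big(\sum_{i=1}^m\Big\|\sum_{\nu\in\Lambda}A_{i,\nu}z_\nu-b^{(i)}\Big\|_{\mathcal X}^2\Big)^{1/2}\le\sqrt m\,\varepsilon,$$ then $\widetilde f(y):=\sum_{\nu\in\Lambda}\widetilde F_\nu T_\nu(y)$ satisfies $$\|f-\widetilde f\|_{L^\infty}\le\|f-\widetilde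 f\|_{\mathcal X,1}^{(\omega)}\le c\,\sigma_s(f)_{\mathcal X,1}^{(\omega)}+d\sqrt s\,\varepsilon,\qquad \|f-\widetilde f\|_{L^2}=\|f-\widetilde f\|_{\mathcal X,2}\le\frac{c'}{\sqrt s}\sigma_s(f)_{\mathcal X,1}^{(\omega)}+d'\varepsilon.$$
   Context: For $g=\sum_{\nu\in\Lambda}g_\nu T_\nu$ with $g_\nu\in\mathcal X$: $\|g\|_{\mathcal X,p}^{(\omega)}=\big(\sum_\nu\omega_\nu^{2-p}\|g_\nu\|_{\mathcal X}^p\big)^{1/p}$ (so $\|g\|_{\mathcal X,2}^{(\omega)}=\|g\|_{\mathcal X,2}=(\sum_\nu\|g_\nu\|_{\mathcal X}^2)^{1/2}$); $\sigma_s(g)_{\mathcal X,1}^{(\omega)}=\inf\{\|g-h\|_{\mathcal X,1}^{(\omega)}: h=\sum h_\nu T_\nu,\ \sum_{\nu:h_\nu\ne0}\omega_\nu^2\le s\}$. Bochner norms: $\|g\|_{L^2}^2=\int_{\mathcal U}\|g(y)\|_{\mathcal X}^2\,d\eta(y)$, $\|g\|_{L^\infty}=\operatorname{ess\,sup}_{y\in\mathcal U}\|g(y)\|_{\mathcal X}$. $\|T_\nu\|_\infty=\sup_y|T_\nu(y)|$, $\|\omega\|_\infty=\max_\nu\omega_\nu$. *)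

(* Defs.v *)
From HB Require Import structures.
From mathcomp Require Import all_boot all_order all_algebra.
From mathcomp Require Import all_classical all_reals all_analysis.
From mathcomp Require Import ess_sup_inf.
Set Implicit Arguments. Unset Strict Implicit. Unset Printing Implicit Defensive.
Import Order.TTheory GRing.Theory Num.Theory.
Import numFieldNormedType.Exports.
Local Open Scope classical_set_scope.
Local Open Scope ring_scope.

Section Defs.
Context {R : realType}.

(* ip is an inner product on the real normed space X inducing its norm;
   with X complete, (X, ip) is a real Hilbert space. *)
Definition is_inner_product (X : normedModType R) (ip : X -> X -> R) :=
  [/\ forall x y, ip x y = ip y x,
      forall (a : R) (x y z : X), ip (a *: x + y) z = a * ip x z + ip y z
    & forall x, ip x x = `|x| ^+ 2].

Definition orthonormal_system d (U : measurableType d) (eta : probability U R)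
    (Lam : finType) (T : Lam -> U -> R) :=
  (forall nu, measurable_fun [set: U] (T nu)) /\
  (forall nu mu, eta.-integrable [set: U] (fun y => (T nu y * T mu y)%:E) /\
     (\int[eta]_y (T nu y * T mu y)%:E = (if nu == mu then 1 else 0)%:E)%E).

Definition iid_sample d (Om : measurableType d) (P : probability Om R)
    d' (U : measurableType d') (eta : probability U R) (m : nat)
    (Y : 'I_m -> Om -> U) :=
  [/\ forall i, measurable_fun [set: Om] (Y i),
      forall i (A : set U), measurable A -> P (Y i @^-1` A) = eta A
    & forall A : 'I_m -> set U, (forall i, measurable (A i)) ->
        P (\bigcap_i (Y i @^-1` A i)) = (\prod_(i < m) P (Y i @^-1` A i))%E].

End Defs.

Definition expansion {R : realType} {X : normedModType R} {Lam : finType} {U : Type}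
  (T : Lam -> U -> R) (g : Lam -> X) (y : U) : X := \sum_(nu : Lam) T nu y *: g nu.

Definition wnorm1 {R : realType} {X : normedModType R} {Lam : finType}
  (w : Lam -> R) (g : Lam -> X) : R := \sum_(nu : Lam) w nu * `|g nu|.

Definition norm2 {R : realType} {X : normedModType R} {Lam : finType}
  (g : Lam -> X) : R := Num.sqrt (\sum_(nu : Lam) `|g nu| ^+ 2).

Definition wcard {R : realType} {X : normedModType R} {Lam : finType}
  (w : Lam -> R) (h : Lam -> X) : R := \sum_(nu : Lam | h nu != 0) w nu ^+ 2.

Definition sigma_best {R : realType} {X : normedModType R} {Lam : finType}
  (w : Lam -> R) (s : R) (g : Lam -> X) : R :=
  inf [set r : R | exists h : Lam -> X,
          wcard w h <= s /\ r = wnorm1 w (fun nu => g nu - h nu)].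

Definition bochner_L2 {R : realType} {X : normedModType R} d {U : measurableType d}
  (eta : probability U R) (g : U -> X) : R :=
  Num.sqrt (fine (\int[eta]_y (`|g y| ^+ 2)%:E)%E).

Definition bochner_Linf {R : realType} {X : normedModType R} d {U : measurableType d}
  (eta : probability U R) (g : U -> X) : \bar R :=
  ess_sup eta (fun y => (`|g y|)%:E).

Definition feasible {R : realType} {X : normedModType R} {Lam : finType} (m : nat)
  (A : 'I_m -> Lam -> R) (b : 'I_m -> X) (eps : R) (z : Lam -> X) :=
  Num.sqrt (\sum_(i < m) `|\sum_(nu : Lam) A i nu *: z nu - b i| ^+ 2)
    <= Num.sqrt m%:R * eps.

Definition wl1_solution {R : realType} {X : normedModType R} {Lam : finType} (m : nat)
  (w : Lam -> R) (A : 'I_m -> Lam -> R) (b : 'I_m -> X) (eps : R) (z : Lam -> X) :=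
  feasible A b eps z /\
  forall z', feasible A b eps z' -> wnorm1 w z <= wnorm1 w z'.

(* Main.v *)
Require Import Defs.
From HB Require Import structures.
From mathcomp Require Import all_boot all_order all_algebra.
From mathcomp Require Import all_classical all_reals all_analysis.
From mathcomp Require Import ess_sup_inf measurable_realfun.
From mathcomp Require Import ring lra.
Import Order.TTheory GRing.Theory Num.Theory.
Import numFieldNormedType.Exports.
Local Open Scope classical_set_scope.
Local Open Scope ring_scope.

Set Implicit Arguments.
Unset Strict Implicit.
Unset Printing Implicit Defensive.

(** The good event is the one-sided inequality
      ||x||_2^2 <= (64/m) ||A x||_2^2 + ||x||_{1,w}^2 / (16 s)  for all real x.
    Its penalty lifts from R to X by Minkowski's inequality in coordinates, and
    with the cone condition of an l1-minimizer it yields both error bounds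
    directly, without any restricted isometry property.
    For the probability bound, f_x / ||x||_{1,w} is a convex combination of the
    signed atoms +-T_nu/w_nu, which are bounded by 1. Cut such a function g at
    the levels 2^-j, 1 <= j <= J ~ log s. At level j, Maurey's empirical method
    replaces g by an average of about 4^j log s atoms, up to a set of measure
    O(1/s) for both eta and the empirical measure. There are only
    (2B)^(O(4^j log s)) such averages, so Chernoff's lower tail and a union
    bound control the empirical measure of all their level sets of measure at
    least 4^j b_j / (512 s); the shares b_j = 1/J + 2^-j have bounded sum, beat
    the union bound through 1/J, and make the failure probabilities summable to
    gamma through 2^-j. *)

(** * Finite product distributions *)

Section FiniteChernoff.
Context {R : realType}.
Implicit Types x t : R.

(** Since [1 - x <= expR (- x)], it suffices that [(1 + x + 2 * x ^+ 2) * (1 - x)] is at least 1,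
    and this product equals [1 + x ^+ 2 * (1 - 2 * x)]. *)
Lemma expR_le_quad x : x <= 1 / 2 -> expR x <= 1 + x + 2 * x ^+ 2.
Proof.
move=> xle.
have x1 : 0 < 1 - x by lra.
have eN : 1 - x <= expR (- x) by exact: expR_ge1Dx.
have e0 := expR_gt0 x.
have ee : expR x * (1 - x) <= 1.
  apply: (@le_trans _ _ (expR x * expR (- x))); last by rewrite expRxMexpNx_1.
  by rewrite ler_pM2l.
rewrite -(ler_pM2r x1); apply: (le_trans ee).
have : 0 <= x ^+ 2 * (1 - 2 * x) by rewrite mulr_ge0 ?sqr_ge0//; lra.
nra.
Qed.

(** Exponential Markov inequality: every word [th] that is counted has
    [expR (\sum_i u (th i) - t) >= 1], and the sum over all words factors into an [n]-th power. *)
Lemma prod_chernoff (V : finType) n (q u : V -> R) t : (forall v, 0 <= q v) ->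
  \sum_(th : {ffun 'I_n -> V} | t <= \sum_i u (th i)) \prod_i q (th i)
  <= expR (- t) * (\sum_v q v * expR (u v)) ^+ n.
Proof.
move=> q0.
have -> : (\sum_v q v * expR (u v)) ^+ n =
    \sum_(th : {ffun 'I_n -> V}) \prod_i (q (th i) * expR (u (th i))).
  rewrite -(bigA_distr_bigA (fun (_ : 'I_n) v => q v * expR (u v))).
  by rewrite prodr_const card_ord.
rewrite mulr_sumr big_mkcond; apply: ler_sum => th _.
have Q0 : 0 <= \prod_i q (th i) by apply: prodr_ge0.
rewrite big_split/= -expR_sum mulrCA -expRD.
case: ifP => [tle|_]; last by rewrite mulr_ge0// expR_ge0.
rewrite ler_peMr//; apply: le_trans (expR_ge1Dx _).
by rewrite lerDl addrC subr_ge0.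
Qed.

Lemma sum_prod_prob (V : finType) n (q : V -> R) : \sum_v q v = 1 ->
  \sum_(th : {ffun 'I_n -> V}) \prod_i q (th i) = 1.
Proof.
move=> q1; rewrite -(bigA_distr_bigA (fun (_ : 'I_n) v => q v)).
by rewrite prodr_const q1 expr1n.
Qed.

Lemma lower_tail_sum (V : finType) n (q a : V -> R) (p : R) :
  (forall v, 0 <= q v) -> \sum_v q v = 1 -> (forall v, 0 <= a v <= 1) ->
  p = \sum_v q v * a v ->
  \sum_(th : {ffun 'I_n -> V} | \sum_i a (th i) <= n%:R * p / 2)
     \prod_i q (th i) <= expR (- (n%:R * p / 32)).
Proof.
move=> q0 q1 a01 pE.
(* With Chernoff parameter 1/8 the threshold contributes [n p / 16] to the exponent and the [n]
   factors contribute [- 3 n p / 32], which leaves [- n p / 32]. *)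
have := @prod_chernoff V n q (fun v => - (a v / 8)) (- (n%:R * p / 16)) q0.
rewrite (eq_bigl (fun th : {ffun 'I_n -> V} => \sum_i a (th i) <= n%:R * p / 2)); last first.
  move=> th; rewrite sumrN -mulr_suml; apply/idP/idP; lra.
move=> /le_trans; apply.
have le1 : \sum_v q v * expR (- (a v / 8)) <= expR (- (3 * p / 32)).
  apply: (@le_trans _ _ (\sum_v (q v - 3 / 32 * (q v * a v)))).
    apply: ler_sum => v _.
    have /andP[a0 a1] := a01 v.
    have h : expR (- (a v / 8)) <= 1 - 3 / 32 * a v.
      apply: le_trans (@expR_le_quad _ _) _; first by lra.
      have : a v * a v <= a v by rewrite ler_piMl.
      rewrite sqrrN expr2; lra.
    by rewrite (le_trans (ler_wpM2l (q0 v) h))//; lra.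
  rewrite sumrB q1 -mulr_sumr -pE.
  apply: le_trans (expR_ge1Dx _); lra.
have s0 : 0 <= \sum_v q v * expR (- (a v / 8)).
  by apply: sumr_ge0 => v _; rewrite mulr_ge0// expR_ge0.
apply: le_trans (ler_wpM2l (expR_ge0 _) (lerXn2r n _ _ le1)) _;
  rewrite ?nnegrE ?expR_ge0//.
rewrite -expRM_natl -expRD ler_expR -mulr_natl; lra.
Qed.

(* Maurey's empirical method. *)
Lemma maurey_tail (V : finType) n (q v : V -> R) (t : R) :
  (forall k, 0 <= q k) -> \sum_k q k = 1 -> (forall k, `|v k| <= 1) ->
  0 < t <= 1 ->
  \sum_(th : {ffun 'I_n -> V} |
      n%:R * t <= `|\sum_i v (th i) - n%:R * \sum_k q k * v k|)
     \prod_i q (th i) <= 2 * expR (- (n%:R * t ^+ 2 / 8)).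
Proof.
move=> q0 q1 v1 /andP[t0 t1].
set mu := \sum_k q k * v k.
have mu1 : `|mu| <= 1.
  rewrite -q1; apply: le_trans (ler_norm_sum _ _ _) _; apply: ler_sum => k _.
  by rewrite normrM (ger0_norm (q0 k)) ler_piMr.
have side (e : R) : e ^+ 2 = 1 ->
  \sum_(th : {ffun 'I_n -> V} |
      n%:R * t <= e * (\sum_i v (th i) - n%:R * mu))
     \prod_i q (th i) <= expR (- (n%:R * t ^+ 2 / 8)).
  move=> e1.
  (* Parameter [t / 4]: as [|v k - mu| <= 2] and [t <= 1], the exponent is at most 1/2, where the
     quadratic bound on [expR] holds. Per draw the threshold gives [- t ^+ 2 / 4] and the variance
     term at most [t ^+ 2 / 8]. *)
  have := @prod_chernoff V n q (fun k => t / 4 * (e * (v k - mu)))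
    (t / 4 * (n%:R * t)) q0.
  rewrite (eq_bigl (fun th : {ffun 'I_n -> V} =>
    n%:R * t <= e * (\sum_i v (th i) - n%:R * mu))); last first.
    move=> th; rewrite -!mulr_sumr ler_pM2l ?divr_gt0//.
    by rewrite sumrB sumr_const card_ord -[mu *+ n]mulr_natl.
  move=> /le_trans; apply.
  have le1 : \sum_k q k * expR (t / 4 * (e * (v k - mu))) <= expR (t ^+ 2 / 8).
    have step k : q k * expR (t / 4 * (e * (v k - mu))) <=
        q k + t / 4 * e * (q k * v k - q k * mu) +
        t ^+ 2 / 8 * (q k * v k ^+ 2 - 2 * mu * (q k * v k) + mu ^+ 2 * q k).
      have h : expR (t / 4 * (e * (v k - mu))) <=
          1 + t / 4 * (e * (v k - mu)) + 2 * (t / 4 * (e * (v k - mu))) ^+ 2.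
        apply: expR_le_quad.
        have en : `|e| = 1.
          by apply/eqP; rewrite -sqrp_eq1// real_normK ?num_real// e1.
        apply: le_trans (ler_norm _) _.
        rewrite !normrM en mul1r (ger0_norm (_ : 0 <= t)) ?(ltW t0)//.
        have := le_trans (ler_normB (v k) mu) (lerD (v1 k) mu1).
        rewrite (ger0_norm (_ : 0 <= 4^-1))// => h2.
        have h3 := normr_ge0 (v k - mu).
        nra.
      apply: le_trans (ler_wpM2l (q0 k) h) _.
      rewrite !exprMn e1 le_eqVlt; apply/orP; left; apply/eqP; by field.
    apply: le_trans (ler_sum _ (fun k _ => step k)) _.
    rewrite !big_split/= -!mulr_sumr !big_split/= !sumrN -!mulr_sumr -mulr_suml.
    rewrite q1 -/mu mul1r subrr mulr0 addr0 mulr1.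
    apply: le_trans (expR_ge1Dx _).
    rewrite lerD2l ler_piMr// ?divr_ge0 ?sqr_ge0//.
    have : \sum_k q k * v k ^+ 2 <= 1.
      rewrite -q1; apply: ler_sum => k _; rewrite ler_piMr//.
      by rewrite -real_normK ?num_real// exprn_ile1.
    have := sqr_ge0 mu; nra.
  have s0 : 0 <= \sum_k q k * expR (t / 4 * (e * (v k - mu))).
    by apply: sumr_ge0 => k _; rewrite mulr_ge0// expR_ge0.
  apply: le_trans (ler_wpM2l (expR_ge0 _) (lerXn2r n _ _ le1)) _;
    rewrite ?nnegrE ?expR_ge0//.
  rewrite -expRM_natl -expRD ler_expR -mulr_natl; lra.
rewrite mulr2n mulrDl mul1r.
apply: le_trans (lerD (side 1 (expr1n _ _)) (side (-1) _)); last by rewrite sqrrN expr1n.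
rewrite [X in X <= _]big_mkcond [X in _ <= X + _]big_mkcond.
rewrite [X in _ <= _ + X]big_mkcond -big_split/=.
apply: ler_sum => th _; rewrite mul1r mulN1r ler_normr.
have Q0 : 0 <= \prod_i q (th i) by apply: prodr_ge0.
by case: (n%:R * t <= _) => /=; case: (n%:R * t <= _); rewrite ?addr0 ?add0r ?lerDl ?lexx.
Qed.

End FiniteChernoff.

(** * Sampling *)

Section Probability.
Context {R : realType}.

Lemma prob_fineK d (U : measurableType d) (eta : probability U R) (A : set U) :
  measurable A -> (fine (eta A))%:E = eta A.
Proof. by move=> mA; rewrite fineK// fin_num_measure. Qed.

Lemma measure_bigsetU_le d (U : measurableType d) (eta : probability U R)
    (I : Type) (r : seq I) (p : pred I) (D : I -> set U) :
  (forall i, measurable (D i)) ->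
  (eta (\big[setU/set0]_(i <- r | p i) D i) <= \sum_(i <- r | p i) eta (D i))%E.
Proof.
move=> mD; elim: r => [|i r IH]; first by rewrite !big_nil measure0.
rewrite !big_cons; case: (p i) => //.
apply: le_trans (measureU2 _ _ _) _ => //; first exact: bigsetU_measurable.
exact: leeD2l.
Qed.

(** * Integrals of finite combinations of indicators *)

Section Moments.
Context d (U : measurableType d) (eta : probability U R).

Lemma integral_prob_cst (k : R) : (\int[eta]__ k%:E = k%:E)%E.
Proof.
rewrite integral_cst// -[RHS]mule1; congr (_ * _)%E.
exact: (@probability_setT _ _ _ eta).
Qed.

Lemma integral_simple (I : finType) (c : I -> R) (D : I -> set U) (K : R) :
  0 <= K -> (forall i, 0 <= c i) -> (forall i, measurable (D i)) ->
  (\int[eta]_y (K + \sum_i c i * \1_(D i) y)%:E =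
   (K + \sum_i c i * fine (eta (D i)))%:E)%E.
Proof.
move=> K0 c0 mD.
have mi i : measurable_fun [set: U] (fun y => (c i * \1_(D i) y)%:E).
  by apply/measurable_EFinP/measurable_funM => //; exact: measurable_indic.
have i0 i y : (0 <= (c i * \1_(D i) y)%:E)%E.
  by rewrite lee_fin mulr_ge0// indicE ler0n.
under eq_integral do rewrite EFinD -sumEFin.
rewrite ge0_integralD//; last 2 first.
- by move=> y _; apply: sume_ge0.
- exact: emeasurable_sum.
rewrite integral_prob_cst ge0_integral_sum// EFinD -sumEFin.
congr (_ + _)%E; apply: eq_bigr => i _.
under eq_integral do rewrite EFinM.
rewrite ge0_integralZl_EFin//; last first.
  by apply/measurable_EFinP; exact: measurable_indic.
by rewrite integral_indic// setIT EFinM prob_fineK.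
Qed.

Lemma measurable_simple (I : finType) (c : I -> R) (D : I -> set U) (K : R) :
  (forall i, measurable (D i)) ->
  measurable_fun [set: U] (fun y => (K + \sum_i c i * \1_(D i) y)%:E).
Proof.
move=> mD; apply/measurable_EFinP/measurable_funD => //.
by apply: measurable_sum => i; apply: measurable_funM => //; exact: measurable_indic.
Qed.

Lemma integral_le_simple (I : finType) (c : I -> R) (D : I -> set U) (K : R)
    (f : U -> R) :
  0 <= K -> (forall i, 0 <= c i) -> (forall i, measurable (D i)) ->
  measurable_fun [set: U] f -> (forall y, 0 <= f y) ->
  (forall y, f y <= K + \sum_i c i * \1_(D i) y) ->
  (\int[eta]_y (f y)%:E <= (K + \sum_i c i * fine (eta (D i)))%:E)%E.
Proof.
move=> K0 c0 mD mf f0 fle; rewrite -integral_simple//.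
apply: ge0_le_integral => //.
- by move=> y _; rewrite lee_fin.
- exact/measurable_EFinP.
- exact: measurable_simple.
- by move=> y _; rewrite lee_fin.
Qed.

Lemma integral_ge_simple (I : finType) (c : I -> R) (D : I -> set U) (K : R)
    (f : U -> R) :
  0 <= K -> (forall i, 0 <= c i) -> (forall i, measurable (D i)) ->
  measurable_fun [set: U] f ->
  (forall y, K + \sum_i c i * \1_(D i) y <= f y) ->
  ((K + \sum_i c i * fine (eta (D i)))%:E <= \int[eta]_y (f y)%:E)%E.
Proof.
move=> K0 c0 mD mf lef; rewrite -integral_simple//.
apply: ge0_le_integral => //.
- move=> y _; rewrite lee_fin addr_ge0// sumr_ge0// => i _.
  by rewrite mulr_ge0// indicE ler0n.
- exact: measurable_simple.
- exact/measurable_EFinP.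
- by move=> y _; rewrite lee_fin.
Qed.

(** Integrates a tail bound valid at every point: Maurey's estimate becomes a bound on the average
    [eta]-measure of the exceptional sets. *)
Lemma sum_prob_le (I : finType) (c : I -> R) (D : I -> set U) (K : R) :
  (forall i, 0 <= c i) -> (forall i, measurable (D i)) ->
  (forall y, \sum_i c i * \1_(D i) y <= K) ->
  \sum_i c i * fine (eta (D i)) <= K.
Proof.
move=> c0 mD le.
have := @integral_ge_simple I c D 0 (cst K) (lexx _) c0 mD (measurable_cst _).
rewrite integral_prob_cst add0r lee_fin; apply => y.
by rewrite add0r.
Qed.

Lemma sum_prob_level (V : finType) (kap : U -> V) :
  (forall v, measurable (kap @^-1` [set v])) ->
  \sum_v fine (eta (kap @^-1` [set v])) = 1.
Proof.
move=> mk.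
have := @integral_simple V (fun=> 1) (fun v => kap @^-1` [set v]) 0 (lexx _)
  (fun=> ler01) mk.
rewrite (eq_integral (cst 1%E)); last first.
  move=> y _; rewrite add0r (bigD1 (kap y))//= big1 => [|v vk].
    by rewrite addr0 mul1r indicE mem_set.
  by rewrite mul1r indicE memNset// => /= kv; rewrite kv eqxx in vk.
rewrite integral_prob_cst add0r => -[E].
by rewrite [RHS]E; apply: eq_bigr => v _; rewrite mul1r.
Qed.

End Moments.

(** * Lower tails for independent samples *)

Section Sample.
Context dU (U : measurableType dU) (eta : probability U R).
Context dO (Om : measurableType dO) (P : probability Om R).
Context (m : nat) (Y : 'I_m -> Om -> U).
Hypothesis iidY : iid_sample P eta Y.

(** The label map [kap] makes the sample finite: label vectors follow the product law of the cell
    probabilities, so the finite Chernoff bound applies. *)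
Lemma lower_tail_sample (V : finType) (kap : U -> V) (a : V -> R) (p : R) :
  (forall v, measurable (kap @^-1` [set v])) -> (forall v, 0 <= a v <= 1) ->
  p = \sum_v fine (eta (kap @^-1` [set v])) * a v ->
  measurable [set o | \sum_i a (kap (Y i o)) <= m%:R * p / 2] /\
  (P [set o | (\sum_i a (kap (Y i o)) <= m%:R * p / 2)%R] <=
    (expR (- (m%:R * p / 32)))%:E)%E.
Proof.
move=> mk a01 pE; case: iidY => mY lawY indY.
pose D (th : {ffun 'I_m -> V}) :=
  \bigcap_(i in [set: 'I_m]) (Y i @^-1` (kap @^-1` [set th i])).
have mYk i v : measurable (Y i @^-1` (kap @^-1` [set v])).
  by rewrite -[X in measurable X]setTI; apply: mY.
have mD th : measurable (D th) by apply: fin_bigcap_measurable.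
(* Independence is given on rectangles, so the event is cut into the rectangles [D th] on which all
   labels are fixed. *)
have -> : [set o | \sum_i a (kap (Y i o)) <= m%:R * p / 2] =
    \big[setU/set0]_(th : {ffun 'I_m -> V} | \sum_i a (th i) <= m%:R * p / 2) D th.
  rewrite -bigcup_seq_cond; apply/seteqP; split => [x /= le|x [th /= /andP[_ le] Do]].
    exists [ffun i => kap (Y i x)] => /=.
      rewrite mem_index_enum /=; under eq_bigr do rewrite ffunE.
      exact: le.
    by move=> i _ /=; rewrite ffunE.
  rewrite (eq_bigr (fun i => a (th i)))// => i _.
  by rewrite (Do i I).
split; first exact: bigsetU_measurable.
apply: le_trans (measure_bigsetU_le _ _ _ mD) _.
rewrite (eq_bigr (fun th : {ffun 'I_m -> V} =>
   (\prod_i fine (eta (kap @^-1` [set th i])))%:E)); last first.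
  move=> th _; rewrite /D (indY (fun i => kap @^-1` [set th i]))// -prodEFin.
  by apply: eq_bigr => i _; rewrite lawY// prob_fineK.
rewrite sumEFin lee_fin.
by apply: (@lower_tail_sum R V m (fun v => fine (eta (kap @^-1` [set v]))) a p) => // [v|];
  [exact: fine_ge0|exact: sum_prob_level].
Qed.

Lemma lower_tail_set (A : set U) : measurable A ->
  measurable [set o | \sum_i \1_A (Y i o) <= m%:R * fine (eta A) / 2] /\
  (P [set o | (\sum_i \1_A (Y i o) <= m%:R * fine (eta A) / 2)%R] <=
    (expR (- (m%:R * fine (eta A) / 32)))%:E)%E.
Proof.
move=> mA.
have pre b : (fun y => y \in A) @^-1` [set b] = if b then A else ~` A.
  apply/seteqP; split => y /=; case: b => /=.
  - by move/set_mem.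
  - by move=> /negbT; rewrite notin_setE.
  - by move=> yA; rewrite mem_set.
  - by move=> yA; rewrite memNset.
apply: (@lower_tail_sample bool (fun y => y \in A) (fun b => b%:R)) => [b|b|].
- by rewrite pre; case: b => //; exact: measurableC.
- by case: b; rewrite ?lexx ?ler01.
- by rewrite big_bool/= !pre/= mulr0 addr0 mulr1.
Qed.

End Sample.

End Probability.

(** * Dyadic levels and Maurey nets *)

Section Levels.
Context {R : realType}.

Lemma geometric_sum_lt (J : nat) (x : R) : 0 <= x -> x < 1 ->
  \sum_(j < J) x ^+ j <= (1 - x)^-1.
Proof.
move=> x0 x1.
have d0 : 0 < 1 - x by rewrite subr_gt0.
rewrite -(ler_pM2l d0) mulfV ?gt_eqF//.
have := subrX1 x J; rewrite -opprB -[x - 1]opprB mulNr => /oppr_inj <-.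
by rewrite gerBl exprn_ge0.
Qed.

(** Induction on [J]: if [|x|] exceeds the new level, the new summand replaces the old remainder
    [4^-1 ^+ J]; otherwise [x ^+ 2] is already below the new remainder. *)
Lemma sqr_le_levels (J : nat) (x : R) : `|x| <= 1 ->
  x ^+ 2 <= 4^-1 ^+ J + \sum_(j < J) 4^-1 ^+ j * (2^-1 ^+ j.+1 < `|x|)%R%:R.
Proof.
move=> x1; elim: J => [|J IH].
  by rewrite big_ord0 addr0 expr0 -real_normK ?num_real// exprn_ile1.
rewrite big_ord_recr/=; case: ltP => h.
  apply: le_trans IH _; rewrite /= mulr1.
  have : 0 <= 4^-1 ^+ J.+1 :> R by rewrite exprn_ge0.
  lra.
rewrite mulr0 addr0 -real_normK ?num_real//.
have -> : 4^-1 ^+ J.+1 = (2^-1 ^+ J.+1) ^+ 2 :> R.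
  by rewrite exprAC; congr (_ ^+ _); field.
apply: le_trans (_ : (2^-1 ^+ J.+1) ^+ 2 <= _).
  by rewrite lerXn2r ?nnegrE ?exprn_ge0.
by rewrite lerDl sumr_ge0// => j _; rewrite mulr_ge0// exprn_ge0.
Qed.

(** For [x > 1] the full geometric series is small enough; for [x <= 1] the first term vanishes and
    the others are those of [4 * x], scaled by 1/4. *)
Lemma sum_levels_below (J : nat) (x : R) : 0 <= x ->
  \sum_(j < J) 4^-1 ^+ j * (4^-1 ^+ j < x)%R%:R <= 4 / 3 * x.
Proof.
elim: J x => [|J IH] x x0; first by rewrite big_ord0; lra.
case: (ltP 1 x) => [x1|x1].
  apply: (@le_trans _ _ (\sum_(j < J.+1) 4^-1 ^+ j)).
    by apply: ler_sum => j _; rewrite ler_piMr ?exprn_ge0//; case: (_ < _).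
  have q0 : 0 <= 4^-1 :> R by lra.
  have q1 : 4^-1 < 1 :> R by lra.
  apply: le_trans (geometric_sum_lt J.+1 q0 q1) _.
  by have -> : (1 - 4^-1)^-1 = 4 / 3 :> R; [field|lra].
rewrite big_ord_recl/= expr0 ltNge x1 mulr0 add0r.
have h4 : 0 <= 4 * x by lra.
have := IH _ h4.
rewrite -(ler_pM2l (_ : 0 < 4^-1))//= => /(fun h => le_trans _ h) h.
have -> : 4 / 3 * x = 4^-1 * (4 / 3 * (4 * x)) by field.
apply: h; rewrite mulr_sumr; apply: ler_sum => j _.
rewrite /bump/= add1n.
have -> : (4^-1 ^+ j.+1 < x) = (4^-1 ^+ j < 4 * x) by rewrite exprS ltr_pdivrMl.
by rewrite exprS mulrA.
Qed.

(** Converse of [sqr_le_levels] up to a constant, at halved thresholds to leave room for the net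
    error. The condition on [|x|] reads [4^-1 ^+ j < 16 * x ^+ 2], whence the constant 16 * 4/3. *)
Lemma sum_levels_le (J : nat) (x : R) :
  \sum_(j < J) 4^-1 ^+ j * (2^-1 ^+ j.+1 / 2 < `|x|)%R%:R <= 64 / 3 * x ^+ 2.
Proof.
have x0 : 0 <= 16 * x ^+ 2 by rewrite mulr_ge0// sqr_ge0.
have := sum_levels_below J x0.
rewrite (_ : 4 / 3 * (16 * x ^+ 2) = 64 / 3 * x ^+ 2); last by field.
apply: le_trans; apply: ler_sum => j _.
rewrite ler_wpM2l ?exprn_ge0// ler_nat; case: ltP => //= h.
suff -> : 4^-1 ^+ j < 16 * x ^+ 2 by [].
have -> : 4^-1 ^+ j = 16 * (2^-1 ^+ j.+1 / 2) ^+ 2 :> R.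
  have -> : 4^-1 ^+ j = (2^-1 ^+ j) ^+ 2 :> R by rewrite exprAC; congr (_ ^+ _); field.
  by rewrite [2^-1 ^+ j.+1]exprS; move: (2^-1 ^+ j) => u; field.
rewrite ltr_pM2l// -[x ^+ 2]real_normK ?num_real// ltrXn2r//.
Qed.

End Levels.

(** * Signed atoms, Maurey nets and comparison of true and empirical level sets *)

Section Dictionary.
Context {R : realType}.

Lemma exists_le_average (V : finType) (q f : V -> R) (b : R) :
  (forall v, 0 <= q v) -> \sum_v q v = 1 -> \sum_v q v * f v <= b ->
  exists v, f v <= b.
Proof.
move=> q0 q1 le; apply: contrapT => /forallNP nle.
have lt v : b < f v by rewrite ltNge; apply/negP; exact: nle.
have : \sum_v q v * (f v - b) <= 0.
  under eq_bigr do rewrite mulrBr.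
  by rewrite sumrB -mulr_suml q1 mul1r subr_le0.
rewrite le_eqVlt ltNge sumr_ge0 ?orbF => [|v _]; last first.
  by rewrite mulr_ge0// subr_ge0 ltW.
rewrite psumr_eq0 => [/allP h|v _]; last by rewrite mulr_ge0// subr_ge0 ltW.
have : \sum_v q v = 0.
  apply: big1 => v _; have := h v (mem_index_enum v).
  by rewrite mulf_eq0 subr_eq0 (gt_eqF (lt v)) orbF => /eqP.
by rewrite q1 => /eqP; rewrite oner_eq0.
Qed.

Context dU (U : measurableType dU) (eta : probability U R).
Context (Lam : finType) (phi : Lam -> U -> R).
Hypothesis mphi : forall nu, measurable_fun [set: U] (phi nu).
Hypothesis phi1 : forall nu y, `|phi nu y| <= 1.

Definition lincomb (a : Lam -> R) (y : U) : R := \sum_nu a nu * phi nu y.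

Definition signed_atom (k : Lam * bool) (y : U) : R := (-1) ^+ k.2 * phi k.1 y.

Definition netsum n (th : {ffun 'I_n -> Lam * bool}) (y : U) : R :=
  \sum_i signed_atom (th i) y.

Definition emp m (y : 'I_m -> U) (D : set U) : R :=
  m%:R^-1 * \sum_i \1_D (y i).

(** All of [|a nu|] sits on the sign of [a nu]. When these moduli sum to 1, this is Maurey's
    sampling law: a probability vector under which the mean signed atom is [lincomb a]. *)
Definition signed_weight (a : Lam -> R) (k : Lam * bool) : R :=
  if k.2 == (a k.1 < 0) then `|a k.1| else 0.

Lemma signed_weight_ge0 a k : 0 <= signed_weight a k.
Proof. by rewrite /signed_weight; case: ifP. Qed.

Lemma sum_signed_weight a : \sum_k signed_weight a k = \sum_nu `|a nu|.
Proof.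
rewrite -(pair_bigA _ (fun nu b => signed_weight a (nu, b)))/=.
apply: eq_bigr => nu _; rewrite big_bool /signed_weight/=.
by case: (a nu < 0); rewrite ?addr0 ?add0r.
Qed.

Lemma sum_signed_atom a y :
  \sum_k signed_weight a k * signed_atom k y = lincomb a y.
Proof.
rewrite -(pair_bigA _ (fun nu b => signed_weight a (nu, b) * signed_atom (nu, b) y))/=.
apply: eq_bigr => nu _; rewrite big_bool /signed_weight/signed_atom/=.
case: ltP => h; rewrite /= mul0r ?addr0 ?add0r ?expr1 ?expr0 ?mul1r.
  by rewrite ltr0_norm// mulrA mulrN1 opprK.
by rewrite ger0_norm.
Qed.

Lemma signed_atom_le1 k y : `|signed_atom k y| <= 1.
Proof. by rewrite /signed_atom normrM normrX normrN1 expr1n mul1r. Qed.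

Lemma measurable_lincomb a : measurable_fun [set: U] (lincomb a).
Proof. by apply: measurable_sum => nu; apply: measurable_funM. Qed.

Lemma measurable_netsum n (th : {ffun 'I_n -> Lam * bool}) :
  measurable_fun [set: U] (netsum th).
Proof. by apply: measurable_sum => i; apply: measurable_funM. Qed.

Lemma lincomb_le1 a y : \sum_nu `|a nu| = 1 -> `|lincomb a y| <= 1.
Proof.
move=> <-; apply: le_trans (ler_norm_sum _ _ _) _; apply: ler_sum => nu _.
by rewrite normrM ler_piMr.
Qed.

Lemma measurable_norm_gt (f : U -> R) (c : R) : measurable_fun [set: U] f ->
  measurable [set y | c < `|f y|].
Proof.
move=> mf; rewrite -[X in measurable X]setTI.
have -> : [set y | c < `|f y|] = (fun y => `|f y|) @^-1` `]c, +oo[.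
  by apply/seteqP; split => y /=; rewrite in_itv/= andbT.
apply: (measurableT_comp (@normr_measurable R setT) mf) => //.
Qed.

Lemma measurable_norm_ge (f : U -> R) (c : R) : measurable_fun [set: U] f ->
  measurable [set y | c <= `|f y|].
Proof.
move=> mf; rewrite -[X in measurable X]setTI.
have -> : [set y | c <= `|f y|] = (fun y => `|f y|) @^-1` `[c, +oo[.
  by apply/seteqP; split => y /=; rewrite in_itv/= andbT.
apply: (measurableT_comp (@normr_measurable R setT) mf) => //.
Qed.

Lemma emp_le m (y : 'I_m -> U) (A B : set U) : A `<=` B -> emp y A <= emp y B.
Proof.
move=> AB; rewrite ler_wpM2l ?invr_ge0//; apply: ler_sum => i _.
rewrite !indicE ler_nat; case: (boolP (y i \in A)) => // /set_mem /AB h.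
by rewrite mem_set.
Qed.

Lemma empU m (y : 'I_m -> U) (A B : set U) :
  emp y (A `|` B) <= emp y A + emp y B.
Proof.
rewrite -mulrDr ler_wpM2l ?invr_ge0// -big_split/=; apply: ler_sum => i _.
rewrite !indicE -natrD ler_nat in_setU.
by case: (_ \in A); case: (_ \in B).
Qed.

Lemma fine_prob_le (A B : set U) : measurable A -> measurable B -> A `<=` B ->
  fine (eta A) <= fine (eta B).
Proof.
by move=> mA mB AB; rewrite fine_le ?fin_num_measure// le_measure ?inE.
Qed.

Lemma fine_probU (A B : set U) : measurable A -> measurable B ->
  fine (eta (A `|` B)) <= fine (eta A) + fine (eta B).
Proof.
move=> mA mB; rewrite -fineD ?fin_num_measure// fine_le ?fin_num_measure//.
- exact: measurableU.
- by rewrite fin_numD !fin_num_measure.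
- exact: measureU2.
Qed.

(** One net element must serve both measures, so the average of the sum of both errors over random
    words is bounded, 2 + 2 = 4, and some word does no worse than the average. *)
Lemma net_approx n m (y : 'I_m -> U) (a : Lam -> R) (t : R) :
  (0 < m)%N -> \sum_nu `|a nu| = 1 -> 0 < t <= 1 ->
  exists th : {ffun 'I_n -> Lam * bool},
    let D := [set u | n%:R * t <= `|netsum th u - n%:R * lincomb a u|] in
    fine (eta D) + emp y D <= 4 * expR (- (n%:R * t ^+ 2 / 8)).
Proof.
move=> m0 a1 t01.
pose q := signed_weight a.
have q0 k : 0 <= q k by exact: signed_weight_ge0.
have q1 : \sum_k q k = 1 by rewrite sum_signed_weight.
pose D (th : {ffun 'I_n -> Lam * bool}) :=
  [set u | n%:R * t <= `|netsum th u - n%:R * lincomb a u|].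
pose Q (th : {ffun 'I_n -> Lam * bool}) := \prod_i q (th i).
have Q0 th : 0 <= Q th by exact: prodr_ge0.
have mD th : measurable (D th).
  apply: measurable_norm_ge; apply: measurable_funB; first exact: measurable_netsum.
  by apply: measurable_funM => //; exact: measurable_lincomb.
have tail u : \sum_th Q th * \1_(D th) u <= 2 * expR (- (n%:R * t ^+ 2 / 8)).
  have := @maurey_tail R _ n q (fun k => signed_atom k u) t q0 q1
    (fun k => signed_atom_le1 k u) t01.
  rewrite sum_signed_atom; apply: le_trans.
  rewrite [X in _ <= X]big_mkcond; apply: ler_sum => th _.
  rewrite indicE; case: (boolP (u \in D th)) => [/set_mem h|_].
    by rewrite ifT// mulr1.
  by rewrite mulr0; case: ifP => // _; exact: (Q0 th).
apply: (@exists_le_average _ Q (fun th => fine (eta (D th)) + emp y (D th))) => //.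
  exact: sum_prod_prob.
under eq_bigr do rewrite mulrDr.
rewrite big_split/= (_ : 4 = 2 + 2 :> R); last by ring.
rewrite mulrDl lerD//; first exact: sum_prob_le.
rewrite /emp; under eq_bigr do rewrite mulrCA.
rewrite -mulr_sumr ler_pdivrMl ?ltr0n//.
under eq_bigr do rewrite mulr_sumr.
rewrite exchange_big/=.
apply: le_trans (ler_sum _ (fun i _ => tail (y i))) _.
by rewrite sumr_const card_ord -[_ *+ m]mulr_natl.
Qed.

(** The cut at 3/4 lies midway between [tau / 2] and [tau], leaving [tau / 4] on either side for the
    approximation error; [n] appears because [netsum] is not normalized. *)
Definition net_level n (th : {ffun 'I_n -> Lam * bool}) (tau : R) : set U :=
  [set u | n%:R * (3 / 4 * tau) < `|netsum th u|].

Lemma measurable_net_level n (th : {ffun 'I_n -> Lam * bool}) tau :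
  measurable (net_level th tau).
Proof. by apply: measurable_norm_gt; exact: measurable_netsum. Qed.

(** Outside the exceptional set [D] of Maurey's approximation, the level set at [tau] lies in the
    net level, which lies in the level set at [tau / 2]. The cost of [D] is [eta D + 2 emp D], at
    most 8 exponentials. *)
Lemma level_transfer n m (y : 'I_m -> U) (a : Lam -> R) (tau alpha : R) :
  (0 < m)%N -> (0 < n)%N -> \sum_nu `|a nu| = 1 -> 0 < tau <= 1 ->
  (forall th : {ffun 'I_n -> Lam * bool},
     fine (eta (net_level th tau)) <= 2 * emp y (net_level th tau) + alpha) ->
  fine (eta [set u | tau < `|lincomb a u|]) <=
    2 * emp y [set u | tau / 2 < `|lincomb a u|] + alpha +
    12 * expR (- (n%:R * tau ^+ 2 / 128)).
Proof.
move=> m0 n0 a1 /andP[t0 t1] good.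
have t01 : 0 < tau / 4 <= 1 by apply/andP; split; lra.
have [th /=] := @net_approx n m y a (tau / 4) m0 a1 t01.
set D := (X in fine (eta X)).
rewrite (_ : n%:R * (tau / 4) ^+ 2 / 8 = n%:R * tau ^+ 2 / 128); last by field.
set e := expR _ => De.
have np : 0 < n%:R :> R by rewrite ltr0n.
have mA := measurable_net_level th tau.
have mD : measurable D.
  apply: measurable_norm_ge; apply: measurable_funB; first exact: measurable_netsum.
  by apply: measurable_funM => //; exact: measurable_lincomb.
have s1 : [set u | tau < `|lincomb a u|] `<=` net_level th tau `|` D.
  move=> u /= h; case: (leP (n%:R * (tau / 4)) `|netsum th u - n%:R * lincomb a u|) => h2.
    by right.
  left; rewrite /net_level/=.
  have h4 : `|n%:R * lincomb a u| <= `|netsum th u| + `|netsum th u - n%:R * lincomb a u|.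
    rewrite -[X in `|X| <= _](subKr (netsum th u)).
    exact: ler_normB.
  rewrite normrM normr_nat in h4.
  have : n%:R * tau < n%:R * `|lincomb a u| by rewrite ltr_pM2l.
  lra.
have s2 : net_level th tau `<=` [set u | tau / 2 < `|lincomb a u|] `|` D.
  move=> u; rewrite /net_level/= => h.
  case: (leP (n%:R * (tau / 4)) `|netsum th u - n%:R * lincomb a u|) => h2.
    by right.
  left => /=; rewrite -(ltr_pM2l np).
  have h4 : `|netsum th u| <= `|netsum th u - n%:R * lincomb a u| + `|n%:R * lincomb a u|.
    rewrite -[X in `|X| <= _](subrK (n%:R * lincomb a u)).
    exact: ler_normD.
  rewrite [X in _ + X]normrM normr_nat in h4.
  lra.
have eD : 0 <= fine (eta D) by exact: fine_ge0.
have pD : 0 <= emp y D.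
  by rewrite mulr_ge0 ?invr_ge0// sumr_ge0// => i _; rewrite indicE.
have b1 := fine_prob_le (measurable_norm_gt tau (measurable_lincomb a))
  (measurableU _ _ mA mD) s1.
have b2 := fine_probU mA mD.
have b3 := good th.
have b4 := le_trans (emp_le y s2) (empU y _ _).
lra.
Qed.

(** The square is cut into levels under [eta], each level is transferred to the sample, and the
    levels are reassembled into squares at the sample points. The factor is 2 * 64/3, below 64. *)
Lemma second_moment_le m (y : 'I_m -> U) (a : Lam -> R) (J : nat) (r : nat -> R) :
  \sum_nu `|a nu| = 1 ->
  (forall j, (j < J)%N ->
     fine (eta [set u | 2^-1 ^+ j.+1 < `|lincomb a u|]) <=
     2 * emp y [set u | 2^-1 ^+ j.+1 / 2 < `|lincomb a u|] + r j) ->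
  (\int[eta]_u (lincomb a u ^+ 2)%:E <=
   (64 * (m%:R^-1 * (\sum_i lincomb a (y i) ^+ 2)) +
   4^-1 ^+ J + \sum_(j < J) 4^-1 ^+ j * r j)%:E)%E.
Proof.
move=> a1 lev.
have q0 j : 0 <= 4^-1 ^+ j :> R by rewrite exprn_ge0.
pose D (j : nat) := [set u | 2^-1 ^+ j.+1 < `|lincomb a u|].
apply: le_trans (@integral_le_simple R _ U eta 'I_J (fun j => 4^-1 ^+ j) D
  (4^-1 ^+ J) _ _ _ _ _ _ _) _ => //.
- by move=> j; apply: measurable_norm_gt; exact: measurable_lincomb.
- by apply: measurable_funX; exact: measurable_lincomb.
- by move=> u; exact: sqr_ge0.
- move=> u; apply: le_trans (sqr_le_levels J (lincomb_le1 u a1)) _.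
  rewrite lerD2l; apply: ler_sum => j _; rewrite ler_wpM2l//.
  by rewrite indicE ler_nat; case: ltP => // h; rewrite mem_set.
rewrite lee_fin [X in _ <= X + _]addrC -addrA lerD2l.
apply: le_trans (ler_sum _ (fun (j : 'I_J) _ => ler_wpM2l (q0 j) (lev j (ltn_ord j)))) _.
under eq_bigr do rewrite mulrDr.
rewrite big_split/= lerD2r /emp.
under eq_bigr do rewrite 2!(mulrCA (4^-1 ^+ _)).
rewrite -!mulr_sumr mulrCA [64 * _]mulrCA ler_wpM2l ?invr_ge0//.
under [X in 2 * X]eq_bigr do rewrite mulr_sumr.
rewrite exchange_big/= !mulr_sumr; apply: ler_sum => i _.
have := sum_levels_le J (lincomb a (y i)); have := sqr_ge0 (lincomb a (y i)).
have -> : \sum_(j < J) 4^-1 ^+ j * \1_[set u | 2^-1 ^+ j.+1 / 2 < `|lincomb a u|] (y i)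
  = \sum_(j < J) 4^-1 ^+ j * (2^-1 ^+ j.+1 / 2 < `|lincomb a (y i)|)%R%:R :> R.
  apply: eq_bigr => j _; rewrite indicE; congr (_ * _%:R).
  case: ltP => h; first by rewrite mem_set.
  by rewrite memNset//= ltNge h.
lra.
Qed.

End Dictionary.

(** * Number of scales and union bound *)

Section Budgets.
Context {R : realType}.

Lemma expR1_le4 : expR 1 <= 4 :> R.
Proof.
have h : expR (1 / 2) <= 2 :> R.
  by apply: le_trans (@expR_le_quad R _ (lexx _)) _; lra.
have -> : 1 = 1 / 2 + 1 / 2 :> R by lra.
rewrite expRD; have := expR_gt0 (1 / 2 : R); nra.
Qed.

Lemma ln2_ge_half : 1 / 2 <= ln 2 :> R.
Proof.
rewrite -ler_expR lnK ?posrE//.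
by apply: le_trans (@expR_le_quad R _ (lexx _)) _; lra.
Qed.

Lemma expRN1_le_half : expR (-1) <= 1 / 2 :> R.
Proof.
rewrite expRN div1r lef_pV2 ?posrE ?expR_gt0//.
exact: expR_ge1Dx.
Qed.

(** Chosen so that at [tau = 2^-1 ^+ j.+1] Maurey's exponent [n * tau ^+ 2 / 128] is exactly [N]. *)
Definition net_size (N j : nat) : nat := (512 * 4 ^ j * N)%N.

Definition level_share (J j : nat) : R := J%:R^-1 + 2^-1 ^+ j.+1.

(** The factor [4 ^+ j] cancels the weight of level [j] in the second moment, so the total slack is
    governed by the sum of the shares. *)
Definition level_slack (s : R) (J j : nat) : R :=
  4 ^+ j * level_share J j / (128 * s).

Lemma sum_level_share J : \sum_(j < J) level_share J j <= 2.
Proof.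
rewrite big_split/= sumr_const card_ord.
have h : J%:R^-1 *+ J <= 1 :> R.
  case: J => [|J]; first by rewrite mulr0n.
  by rewrite -[_ *+ J.+1]mulr_natl mulfV.
have h2 : \sum_(j < J) 2^-1 ^+ j.+1 <= 1 :> R.
  under eq_bigr do rewrite exprS.
  rewrite -mulr_sumr.
  have q0 : 0 <= 2^-1 :> R by lra.
  have q1 : 2^-1 < 1 :> R by lra.
  have := geometric_sum_lt J q0 q1.
  have -> : (1 - 2^-1)^-1 = 2 :> R by field.
  lra.
lra.
Qed.

(** In units of [1 / s]: truncation costs 1/32, the slacks 2/128, and Maurey's errors 12 * 4/3 *
    1/1024 = 1/64; together exactly 1/16. *)
Lemma error_budget (s : R) (J N : nat) : 0 < s -> 32 * s <= 4 ^+ J ->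
  1024 * s * expR (- N%:R) <= 1 ->
  4^-1 ^+ J + \sum_(j < J) 4^-1 ^+ j *
    (level_slack s J j +
     12 * expR (- ((net_size N j)%:R * (2^-1 ^+ j.+1) ^+ 2 / 128)))
  <= 1 / (16 * s).
Proof.
move=> s0 hJ hN.
have e1 : 4^-1 ^+ J <= 1 / (32 * s) :> R.
  by rewrite exprVn div1r lef_pV2 ?posrE ?exprn_gt0 ?mulr_gt0.
have e2 : expR (- N%:R) <= 1 / (1024 * s).
  rewrite ler_pdivlMr; last by rewrite mulr_gt0 ?ltr0n.
  rewrite mulrC; exact: hN.
have -> : \sum_(j < J) 4^-1 ^+ j *
    (level_slack s J j +
     12 * expR (- ((net_size N j)%:R * (2^-1 ^+ j.+1) ^+ 2 / 128)))
  = (\sum_(j < J) level_share J j) / (128 * s) +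
    12 * expR (- N%:R) * \sum_(j < J) 4^-1 ^+ j.
  rewrite mulr_suml mulr_sumr -big_split/=; apply: eq_bigr => j _.
  have -> : (net_size N j)%:R * (2^-1 ^+ j.+1) ^+ 2 / 128 = N%:R :> R.
    rewrite /net_size !natrM natrX.
    have -> : (2^-1 ^+ j.+1) ^+ 2 = 4^-1 * (4 ^+ j)^-1 :> R.
      by rewrite -exprVn -exprS exprAC; congr (_ ^+ _); field.
    by field; rewrite ?expf_neq0.
  rewrite mulrDr; congr (_ + _); last by rewrite mulrC.
  rewrite /level_slack exprVn !mulrA mulVf ?mul1r//.
have g : \sum_(j < J) 4^-1 ^+ j <= 4 / 3 :> R.
  have q0 : 0 <= 4^-1 :> R by lra.
  have q1 : 4^-1 < 1 :> R by lra.
  have := geometric_sum_lt J q0 q1.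
  by have -> : (1 - 4^-1)^-1 = 4 / 3 :> R by field.
have g0 : 0 <= \sum_(j < J) 4^-1 ^+ j :> R by rewrite sumr_ge0// => j _; rewrite exprn_ge0.
have e0 := expR_gt0 (- N%:R : R).
have f1 : (\sum_(j < J) level_share J j) / (128 * s) <= 2 / (128 * s).
  by rewrite ler_pM2r ?invr_gt0 ?mulr_gt0// sum_level_share.
have f2 : 12 * expR (- N%:R) * \sum_(j < J) 4^-1 ^+ j <= 16 * (1 / (1024 * s)).
  apply: (@le_trans _ _ (12 * expR (- N%:R) * (4 / 3))); last by lra.
  by rewrite ler_wpM2l// mulr_ge0// ltW.
apply: (le_trans (lerD e1 (lerD f1 f2))).
by rewrite le_eqVlt; apply/orP; left; apply/eqP; field; rewrite gt_eqF.
Qed.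

(** [J] and [N] are one plus the integer parts of [ln (32 s)] and [ln (1024 s)]. The additive
    constants are absorbed through [ln 2 <= ln s] and [1 <= 2 * ln 2], giving 5 + 1 + 2 = 8 and 10 +
    1 + 2 = 13. *)
Lemma choose_depths (s : R) : 2 <= s -> exists J N : nat,
  [/\ (0 < J)%N, (0 < N)%N, 32 * s <= 4 ^+ J, 1024 * s * expR (- N%:R) <= 1 &
      J%:R <= 8 * ln s /\ N%:R <= 13 * ln s].
Proof.
move=> s2; have s0 : 0 < s by lra.
have l2 := ln2_ge_half.
have ls : ln 2 <= ln s :> R by rewrite ler_ln ?posrE.
have pow k : ln (2 ^+ k * s) = k%:R * ln 2 + ln s.
  by rewrite lnM ?posrE ?exprn_gt0// lnXn// mulr_natl.
have b1 := truncnS_gt (ln (2 ^+ 5 * s)).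
have b2 := truncnS_gt (ln (2 ^+ 10 * s)).
have u k : (Num.truncn (ln (2 ^+ k * s)))%:R <= ln (2 ^+ k * s).
  by rewrite truncn_le pow addr_ge0// ?mulr_ge0//; lra.
have u1 := u 5; have u2 := u 10.
exists (Num.truncn (ln (2 ^+ 5 * s))).+1, (Num.truncn (ln (2 ^+ 10 * s))).+1.
split; [by []|by []|..].
- have -> : 32 * s = expR (ln (2 ^+ 5 * s)).
    rewrite lnK; last by rewrite posrE mulr_gt0 ?exprn_gt0.
    by congr (_ * _); ring.
  apply: (@le_trans _ _ (expR (Num.truncn (ln (2 ^+ 5 * s))).+1%:R)).
    by rewrite ler_expR ltW.
  by rewrite -[X in expR X]mulr1 expRM_natl lerXn2r ?nnegrE ?expR_ge0// expR1_le4.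
- have -> : 1024 * s = expR (ln (2 ^+ 10 * s)).
    rewrite lnK; last by rewrite posrE mulr_gt0 ?exprn_gt0.
    by congr (_ * _); ring.
  by rewrite -expRD -[leRHS]expR0 ler_expR subr_le0 ltW.
have p1 := pow 5; have p2 := pow 10.
by split; rewrite -addn1 natrD; lra.
Qed.

Lemma union_budget (s gamma : R) (B J N m : nat) : 2 <= s -> (1 < B)%N ->
  0 < gamma < 1 -> (0 < J)%N ->
  J%:R <= 8 * ln s -> N%:R <= 13 * ln s ->
  2 * 1024 ^+ 3 * s * Num.max (ln s ^+ 3 * ln (B%:R)) (ln gamma^-1) <= m%:R ->
  \sum_(j < J) ((B * 2) ^ (net_size N j))%:R *
     expR (- (m%:R * level_slack s J j / 32)) <= gamma.
Proof.
move=> s2 B2 /andP[g0 g1] J0 hJ hN hm.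
have s0 : 0 < s by lra.
set C : R := 2 * 1024 ^+ 3 in hm.
have CE : C = 2 * (1024 * (1024 * 1024)) by rewrite /C !exprS expr0 mulr1.
have C0 : 0 <= C by rewrite CE; lra.
move: C hm CE C0 => C hm CE C0.
set M := m%:R / s.
have l2 := ln2_ge_half.
have ls : 1 / 2 <= ln s by apply: le_trans l2 _; rewrite ler_ln ?posrE.
have lB : 1 / 2 <= ln (B%:R) :> R.
  by apply: le_trans l2 _; rewrite ler_ln ?posrE ?ltr0n ?ler_nat// ltnW.
have M1 : C * (ln s ^+ 3 * ln (B%:R)) <= M.
  rewrite /M ler_pdivlMr//; apply: le_trans hm.
  rewrite mulrAC ler_wpM2l//; first by rewrite mulr_ge0// ltW.
  by rewrite le_max lexx.
have M2 : C * ln gamma^-1 <= M.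
  rewrite /M ler_pdivlMr//; apply: le_trans hm.
  rewrite mulrAC ler_wpM2l//; first by rewrite mulr_ge0// ltW.
  by rewrite le_max lexx orbT.
have lg : 0 <= ln gamma^-1 by rewrite ln_ge0// invf_ge1// ltW.
have l3 : 1 / 8 <= ln s ^+ 3.
  have -> : 1 / 8 = (1 / 2) ^+ 3 :> R by field.
  by rewrite lerXn2r ?nnegrE//; lra.
have M3 : C / 16 <= M.
  apply: le_trans M1; rewrite ler_wpM2l//.
  by clear -l3 lB; nra.
have slackE j : m%:R * level_slack s J j / 32 = M * 4 ^+ j * level_share J j / (4 * 1024).
  by rewrite /level_slack /M; field; rewrite ?gt_eqF.
have q0 j : 0 < 4 ^+ j :> R by rewrite exprn_gt0.
have M0 : 0 <= M by apply: le_trans M3; rewrite divr_ge0.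
have p8 : 0 < (8 * 1024)^-1 :> R by rewrite invr_gt0 mulr_gt0 ?ltr0n.
have pl : 0 < (8 * ln s)^-1 by rewrite invr_gt0; clear -ls; lra.
have Mq0 j : 0 <= M * 4 ^+ j by apply: mulr_ge0; [exact: M0|exact: ltW].
have Jp : 0 < J%:R :> R by rewrite ltr0n.
have term j : ((B * 2) ^ (net_size N j))%:R *
     expR (- (m%:R * level_slack s J j / 32)) <= gamma * 2^-1 ^+ j.+1.
  have B0 : 0 < B%:R :> R by rewrite ltr0n ltnW.
  have x0 : 0 < (B * 2)%:R :> R by rewrite ltr0n muln_gt0 ltnW.
  have cardE : ((B * 2) ^ (net_size N j))%:R =
      expR ((net_size N j)%:R * ln ((B * 2)%:R)) :> R.
    by rewrite expRM_natl lnK ?posrE// natrX.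
  have lnB2 : ln ((B * 2)%:R) <= 2 * ln (B%:R) :> R.
    have h : ln 2 <= ln (B%:R) :> R by rewrite ler_ln ?posrE// ler_nat.
    rewrite natrM lnM ?posrE//; lra.
  (* The share [1 / J] pays for the number of words. Of the three logarithms one covers [N], one
     covers [J], and the last enters through [ln s >= 1 / 2]. *)
  have half1 : (net_size N j)%:R * ln ((B * 2)%:R) <=
      M * 4 ^+ j * level_share J j / (8 * 1024).
    apply: (@le_trans _ _ (512 * 4 ^+ j * (13 * ln s) * (2 * ln (B%:R)))).
      have p512 : 0 <= 512 * 4 ^+ j :> R by rewrite mulr_ge0 ?ler0n ?ltW.
      have lnB0 : 0 <= ln ((B * 2)%:R) :> R by rewrite ln_ge0// ler1n muln_gt0 ltnW.
      apply: ler_pM; [exact: ler0n|exact: lnB0| |exact: lnB2].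
      rewrite /net_size !natrM natrX; apply: ler_wpM2l; [exact: p512|exact: hN].
    apply: (@le_trans _ _ (M * 4 ^+ j * (8 * ln s)^-1 / (8 * 1024))); last first.
      rewrite (ler_pM2r p8); apply: ler_wpM2l; first exact: Mq0.
      rewrite /level_share -[leLHS]addr0; apply: lerD; last by rewrite exprn_ge0.
      rewrite lef_pV2 ?posrE; [exact: hJ| |exact: Jp].
      by rewrite -invr_gt0.
    apply: (@le_trans _ _ (C * (ln s ^+ 3 * ln B%:R) * 4 ^+ j * (8 * ln s)^-1 / (8 * 1024))).
      have -> : C * (ln s ^+ 3 * ln B%:R) * 4 ^+ j * (8 * ln s)^-1 / (8 * 1024) =
         4 ^+ j * ln s * ln B%:R * (C / (64 * 1024) * ln s).
        by field; rewrite gt_eqF//; clear -ls; lra.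
      have -> : 512 * 4 ^+ j * (13 * ln s) * (2 * ln B%:R) =
         4 ^+ j * ln s * ln B%:R * (13 * 1024) by ring.
      apply: ler_wpM2l; last by rewrite CE; clear -ls; lra.
      have lsB : 0 <= ln s * ln B%:R by clear -ls lB; nra.
      by rewrite -mulrA; apply: mulr_ge0; [exact: ltW|exact: lsB].
    by rewrite (ler_pM2r p8) (ler_pM2r pl) (ler_pM2r (q0 j)).
  (* The share [2^-1 ^+ j.+1] leaves a factor of order [2 ^+ j], which dominates [j.+1]. The
     remaining [expR (- j.+1%:R)] makes the levels summable to [gamma]. *)
  have half2 : ln gamma^-1 + j.+1%:R <= M * 4 ^+ j * level_share J j / (8 * 1024).
    apply: (@le_trans _ _ (M * 4 ^+ j * 2^-1 ^+ j.+1 / (8 * 1024))); last first.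
      rewrite (ler_pM2r p8); apply: ler_wpM2l; first exact: Mq0.
      by rewrite /level_share lerDr invr_ge0 ltW.
    have -> : M * 4 ^+ j * 2^-1 ^+ j.+1 / (8 * 1024) = M / (16 * 1024) * 2 ^+ j.
      have -> : 4 ^+ j = 2 ^+ j * 2 ^+ j :> R by rewrite -exprMn; congr (_ ^+ _); ring.
      by rewrite exprS exprVn; field; rewrite ?expf_neq0.
    have jle : j.+1%:R <= 2 ^+ j :> R by rewrite -natrX ler_nat ltn_expl.
    have j1 : 1 <= 2 ^+ j :> R by apply: le_trans jle; rewrite ler1n.
    have m1 : ln gamma^-1 + 1 <= M / (16 * 1024) by rewrite CE in M2 M3; clear -M2 M3 lg; lra.
    clear -jle j1 m1 lg; nra.
  rewrite cardE -expRD slackE.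
  apply: (@le_trans _ _ (expR (- (ln gamma^-1 + j.+1%:R)))).
    by rewrite ler_expR; lra.
  rewrite opprD expRD expRN lnK ?posrE ?invr_gt0// invrK ler_pM2l//.
  rewrite -mulrN1 expRM_natl lerXn2r ?nnegrE ?expR_ge0//.
  by apply: le_trans expRN1_le_half _; lra.
apply: le_trans (ler_sum _ (fun (j : 'I_J) _ => term j)) _.
rewrite -mulr_sumr ler_piMr//; first exact: ltW.
have q00 : 0 <= 2^-1 :> R by lra.
have q1 : 2^-1 < 1 :> R by lra.
have := geometric_sum_lt J q00 q1.
have -> : (1 - 2^-1)^-1 = 2 :> R by field.
under [in X in _ -> X]eq_bigr do rewrite exprS.
rewrite -mulr_sumr; lra.
Qed.

End Budgets.

(** * The good event *)

Section GoodEvent.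
Context {R : realType}.
Context dU (U : measurableType dU) (eta : probability U R).
Context (Lam : finType) (T : Lam -> U -> R).
Hypothesis onT : orthonormal_system eta T.
Context (w : Lam -> R).
Hypothesis Tw : forall nu y, `|T nu y| <= w nu.

(** The arbitrary kernel [G] serves both squares of real combinations and, with inner products as
    entries, squared norms in the Hilbert space. *)
Lemma integral_quadratic (G : Lam -> Lam -> R) :
  (\int[eta]_y (\sum_nu \sum_mu T nu y * T mu y * G nu mu)%:E =
   (\sum_nu G nu nu)%:E)%E.
Proof.
case: onT => mT oT.
have int2 nu mu : eta.-integrable [set: U] (fun y => (G nu mu)%:E * (T nu y * T mu y)%:E)%E.
  by apply: integrableZl => //; case: (oT nu mu).
have int1 nu : eta.-integrable [set: U]
    (fun y => \sum_mu (G nu mu)%:E * (T nu y * T mu y)%:E)%E.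
  by apply: integrable_sum.
transitivity (\int[eta]_y (\sum_nu \sum_mu (G nu mu)%:E * (T nu y * T mu y)%:E))%E.
  apply: eq_integral => y _; rewrite -sumEFin; apply: eq_bigr => nu _.
  by rewrite -sumEFin; apply: eq_bigr => mu _; rewrite mulrC EFinM.
rewrite integral_sum// -sumEFin; apply: eq_bigr => nu _.
rewrite integral_sum// (bigD1 nu)//= big1 => [|mu munu].
  rewrite integralZl//; last by case: (oT nu nu).
  by case: (oT nu nu) => _ ->; rewrite eqxx mule1 adde0.
rewrite integralZl//; last by case: (oT nu mu).
by case: (oT nu mu) => _ ->; rewrite eq_sym (negbTE munu) mule0.
Qed.

(** The unit second moment of [T nu] is at most [w nu ^+ 2]; the sign of [w nu] comes from a point
    of [U], which exists because [eta] has mass 1. *)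
Lemma weight_ge1 nu : 1 <= w nu.
Proof.
case: onT => mT oT.
have w0 : 0 <= w nu.
  have [y _] : [set: U] !=set0.
    apply/set0P/eqP => U0; have := @probability_setT _ _ _ eta.
    by rewrite U0 measure0 => -[] /esym/eqP; rewrite oner_eq0.
  exact: le_trans (Tw nu y).
have [_ T1] := oT nu nu; rewrite eqxx in T1.
have := @integral_le_simple R _ U eta 'I_0 (fun=> 0) (fun=> set0) (w nu ^+ 2)
  (fun y => T nu y * T nu y).
rewrite T1 lee_fin big_ord0 addr0 => h.
rewrite -(@expr_ge1 _ 2)//; apply: h => //.
- by rewrite sqr_ge0.
- exact: measurable_funM.
- by move=> y; rewrite -expr2 sqr_ge0.
- move=> y; rewrite big_ord0 addr0 -expr2 -real_normK ?num_real//.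
  by rewrite lerXn2r ?nnegrE.
Qed.

Definition atom nu y : R := T nu y / w nu.

Lemma measurable_atom nu : measurable_fun [set: U] (atom nu).
Proof. by case: onT => mT _; apply: measurable_funM. Qed.

Lemma atom_le1 nu y : `|atom nu y| <= 1.
Proof.
have w0 : 0 < w nu by apply: lt_le_trans (weight_ge1 nu).
by rewrite normrM normfV (gtr0_norm w0) ler_pdivrMr// mul1r.
Qed.

Lemma lincomb_atom (x : Lam -> R) (L : R) y :
  lincomb atom (fun nu => w nu * x nu / L) y = (\sum_nu T nu y * x nu) / L.
Proof.
rewrite mulr_suml; apply: eq_bigr => nu _; rewrite /atom.
have w0 : w nu != 0 by rewrite gt_eqF// (lt_le_trans _ (weight_ge1 nu)).
by move: (L^-1) => l; field.
Qed.

Context dO (Om : measurableType dO) (P : probability Om R).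
Context (m : nat) (Y : 'I_m -> Om -> U).
Hypothesis iidY : iid_sample P eta Y.

Definition lower_isometry (s : R) (o : Om) :=
  forall x : Lam -> R, \sum_nu x nu ^+ 2 <=
    64 * (m%:R^-1 * \sum_i (\sum_nu T nu (Y i o) * x nu) ^+ 2) +
    (\sum_nu w nu * `|x nu|) ^+ 2 / (16 * s).

(** By homogeneity: dividing by the weighted l1 norm [L] turns [x] into coefficients of absolute sum
    1 on the atoms. If [L] is 0 then [x] is 0, the weights being positive. *)
Lemma lower_isometry_of_atoms (s : R) (o : Om) : 0 < s ->
  (forall a : Lam -> R, \sum_nu `|a nu| = 1 ->
     (\int[eta]_u (lincomb atom a u ^+ 2)%:E <=
      (64 * (m%:R^-1 * \sum_i lincomb atom a (Y i o) ^+ 2) + 1 / (16 * s))%:E)%E) ->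
  lower_isometry s o.
Proof.
move=> s0 H x.
set L := \sum_nu w nu * `|x nu|.
have w0 nu : 0 < w nu by apply: lt_le_trans (weight_ge1 nu).
have t0 nu : 0 <= w nu * `|x nu| by rewrite mulr_ge0// ltW.
have [L0|L0] := eqVneq L 0.
  have x0 nu : x nu = 0.
    have /eqP := L0; rewrite psumr_eq0// => /allP/(_ nu (mem_index_enum nu)).
    by rewrite /= mulf_eq0 (gt_eqF (w0 nu))/= normr_eq0 => /eqP.
  rewrite big1 => [|nu _]; last by rewrite x0 expr0n.
  rewrite addr_ge0//.
    by rewrite !mulr_ge0 ?invr_ge0// sumr_ge0// => i _; rewrite sqr_ge0.
  by rewrite divr_ge0 ?sqr_ge0// mulr_ge0 ?ltW.
have Lp : 0 < L by rewrite lt_def L0 sumr_ge0.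
have := H (fun nu => w nu * x nu / L).
have -> : \sum_nu `|w nu * x nu / L| = 1.
  under eq_bigr do rewrite 2!normrM (gtr0_norm (w0 _)) normfV (gtr0_norm Lp).
  by rewrite -mulr_suml mulfV.
move=> /(_ erefl).
have sqE y : lincomb atom (fun nu => w nu * x nu / L) y ^+ 2 =
    \sum_nu \sum_mu T nu y * T mu y * (x nu * x mu / L ^+ 2).
  rewrite lincomb_atom exprMn exprVn; move: (L ^+ 2)^-1 => l.
  rewrite expr2 !mulr_suml; apply: eq_bigr => nu _.
  by rewrite mulr_sumr mulr_suml; apply: eq_bigr => mu _; ring.
under eq_integral do rewrite sqE.
rewrite (integral_quadratic (fun nu mu => x nu * x mu / L ^+ 2)) lee_fin.
under eq_bigr do rewrite -expr2.
under [X in _ <= _ * (_ * X) + _]eq_bigr do rewrite lincomb_atom expr_div_n.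
rewrite -!mulr_suml ler_pdivrMr ?exprn_gt0// => /le_trans; apply.
move: (m%:R^-1) => mi; rewrite le_eqVlt; apply/orP; left; apply/eqP; field.
by rewrite L0 gt_eqF.
Qed.

Lemma good_event_many (s gamma : R) :
  2 <= s -> (1 < #|Lam|)%N -> 0 < gamma < 1 -> (0 < m)%N ->
  2 * 1024 ^+ 3 * s * Num.max (ln s ^+ 3 * ln (#|Lam|%:R)) (ln gamma^-1) <= m%:R ->
  exists E : set Om, [/\ measurable E, ((1 - gamma)%:E <= P E)%E &
    forall o, E o -> lower_isometry s o].
Proof.
move=> s2 B2 g01 m0 hm.
have s0 : 0 < s by apply: lt_le_trans s2.
have [J [N [J0 N0 hJ hN [J8 N13]]]] := choose_depths s2.
have ub := union_budget s2 B2 g01 J0 J8 N13 hm.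
pose n j := net_size N j.
have n0 j : (0 < n j)%N by rewrite !muln_gt0 N0 expn_gt0.
pose tau j : R := 2^-1 ^+ j.+1.
pose alpha j := level_slack s J j.
pose A j (th : {ffun 'I_(n j) -> Lam * bool}) := net_level atom th (tau j).
have mA j th : measurable (A j th) by apply: measurable_net_level; exact: measurable_atom.
(* Net levels of measure at most the slack satisfy the desired inequality on every sample, so only
   larger ones, whose lower tails are small enough for the union bound, can fail. *)
pose bad j th := if fine (eta (A j th)) <= alpha j then set0 else
  [set o | \sum_i \1_(A j th) (Y i o) <= m%:R * fine (eta (A j th)) / 2].
have mbad j th : measurable (bad j th).
  by rewrite /bad; case: ifP => // _; case: (lower_tail_set iidY (mA j th)).
pose Bad := \big[setU/set0]_(j < J) \big[setU/set0]_th bad j th.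
have mBad : measurable Bad by apply: bigsetU_measurable => j _; exact: bigsetU_measurable.
have PBad : (P Bad <= gamma%:E)%E.
  apply: le_trans (measure_bigsetU_le _ _ _ _) _ => [j|]; first exact: bigsetU_measurable.
  apply: (@le_trans _ _ (\sum_(j < J) (((#|Lam| * 2) ^ (net_size N j))%:R *
     expR (- (m%:R * level_slack s J j / 32)))%:E)%E); last by rewrite sumEFin lee_fin.
  apply: lee_sum => j _.
  apply: le_trans (measure_bigsetU_le _ _ _ (mbad j)) _.
  apply: (@le_trans _ _ (\sum_(th : {ffun 'I_(n j) -> Lam * bool})
     (expR (- (m%:R * level_slack s J j / 32)))%:E)%E); last first.
    rewrite sumEFin lee_fin sumr_const.
    by rewrite card_ffun card_prod card_bool card_ord [leRHS]mulrC [leRHS]mulr_natr.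
  apply: lee_sum => th _; rewrite /bad; case: ifPn => [_|].
    by rewrite measure0 lee_fin expR_ge0.
  rewrite -ltNge => lt.
  apply: le_trans (lower_tail_set iidY (mA j th)).2 _.
  rewrite lee_fin ler_expR lerN2 ler_pM2r ?invr_gt0//.
  by rewrite ler_wpM2l// ltW.
exists (~` Bad); split; first exact: measurableC.
  rewrite probability_setC// EFinB; apply: leeB => //.
move=> o oG; apply: lower_isometry_of_atoms => // a a1.
have good j : (j < J)%N -> forall th,
    fine (eta (A j th)) <= 2 * emp (fun i => Y i o) (A j th) + alpha j.
  move=> jJ th.
  have e0 : 0 <= emp (fun i => Y i o) (A j th) :> R.
    by rewrite /emp mulr_ge0 ?invr_ge0// sumr_ge0// => i _; rewrite indicE.
  case: (leP (fine (eta (A j th))) (alpha j)) => [h|h]; first by lra.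
  have nb : ~ bad j th o.
    move=> b; apply: oG; rewrite /Bad -bigcup_seq; exists (Ordinal jJ) => /=.
      exact: mem_index_enum.
    by rewrite -bigcup_seq; exists th => //=; exact: mem_index_enum.
  rewrite /bad leNgt h/= in nb.
  have {}nb : m%:R * fine (eta (A j th)) / 2 < \sum_i \1_(A j th) (Y i o).
    by rewrite ltNge; apply/negP.
  have : fine (eta (A j th)) / 2 <= emp (fun i => Y i o) (A j th) :> R.
    by rewrite /emp ler_pdivlMl ?ltr0n// mulrA ltW.
  have : 0 <= alpha j.
    by rewrite divr_ge0 ?mulr_ge0 ?exprn_ge0 ?addr_ge0 ?invr_ge0 ?exprn_ge0 ?ltW// ltr0n.
  lra.
pose r j := alpha j + 12 * expR (- ((n j)%:R * tau j ^+ 2 / 128)).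
have lev j : (j < J)%N ->
     fine (eta [set u | tau j < `|lincomb atom a u|]) <=
     2 * emp (fun i => Y i o) [set u | tau j / 2 < `|lincomb atom a u|] + r j.
  move=> jJ; rewrite /r addrA; apply: level_transfer => //.
  - exact: measurable_atom.
  - exact: atom_le1.
  - by rewrite exprn_gt0//= exprn_ile1//; lra.
  - exact: good.
apply: le_trans (second_moment_le measurable_atom atom_le1 a1 lev) _.
rewrite lee_fin -addrA lerD2l.
exact: error_budget.
Qed.

End GoodEvent.

(** * The good event for a single atom, and all cases together *)

Section GoodEventSmall.
Context {R : realType}.
Context dU (U : measurableType dU) (eta : probability U R).
Context (Lam : finType) (T : Lam -> U -> R).
Hypothesis onT : orthonormal_system eta T.
Context (w : Lam -> R).
Hypothesis Tw : forall nu y, `|T nu y| <= w nu.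
Context dO (Om : measurableType dO) (P : probability Om R).
Context (m : nat) (Y : 'I_m -> Om -> U).
Hypothesis iidY : iid_sample P eta Y.

(* With a single atom the union bound is not available: its multiplicative
   prefactor would be fatal when gamma is close to 1. *)
Lemma good_event_one (s gamma : R) (nu : Lam) :
  (forall x : Lam, x = nu) -> 2 * w nu ^+ 2 <= s -> 0 < gamma < 1 -> (0 < m)%N ->
  27 * s * ln gamma^-1 <= m%:R ->
  exists E : set Om, [/\ measurable E, ((1 - gamma)%:E <= P E)%E &
    forall o, E o -> lower_isometry T w Y s o].
Proof.
move=> nuE ws /andP[g0 g1] m0 hm; case: (onT) => mT oT.
have w1 : 1 <= w nu := weight_ge1 onT Tw nu.
have w21 : 1 <= w nu ^+ 2 by rewrite expr_ge1// (le_trans _ w1).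
have s0 : 0 < s by lra.
have mp : 0 < m%:R :> R by rewrite ltr0n.
(* Rounding [4 * T nu y ^+ 2] down to an integer gives finitely many labels and loses at most 1/4 of
   the unit second moment. *)
pose h y : R := 4 * T nu y ^+ 2.
have h0 y : 0 <= h y by rewrite mulr_ge0// sqr_ge0.
have mh : measurable_fun [set: U] h by apply: measurable_funM => //; exact: measurable_funX.
pose k := Num.truncn (4 * w nu ^+ 2).
have hk y : (Num.truncn (h y) < k.+1)%N.
  rewrite ltnS; apply: le_truncn; rewrite ler_pM2l//.
  rewrite -[T nu y ^+ 2]real_normK ?num_real// lerXn2r ?nnegrE//.
  exact: le_trans w1.
have kle : k.+1%:R <= 5 / 2 * s.
  have := truncn_le (4 * w nu ^+ 2); rewrite mulr_ge0 ?sqr_ge0// => kk.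
  rewrite -addn1 natrD; have : k%:R <= 4 * w nu ^+ 2 by rewrite /k kk.
  lra.
have kp : 0 < k.+1%:R :> R by rewrite ltr0n.
pose kap y : 'I_k.+1 := Ordinal (hk y).
have kapE v : kap @^-1` [set v] = h @^-1` `[v%:R, v.+1%:R[.
  apply/seteqP; split => y /=; rewrite in_itv/=.
    by move=> <-; exact: truncn_itv.
  by move=> hv; apply: val_inj => /=; exact: truncn_def.
have mkap v : measurable (kap @^-1` [set v]).
  by rewrite kapE -[X in measurable X]setTI; exact: mh.
pose a (v : 'I_k.+1) : R := v%:R / k.+1%:R.
have a01 v : 0 <= a v <= 1.
  by rewrite divr_ge0//= ler_pdivrMr// mul1r ler_nat ltnW.
pose p := \sum_v fine (eta (kap @^-1` [set v])) * a v.
(* The mean of [h] is 4 and rounding down costs at most 1, so the mean label is at least 3. *)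
have p3 : 3 / k.+1%:R <= p.
  have [_ T1] := oT nu nu; rewrite eqxx in T1.
  have := @integral_le_simple R _ U eta 'I_k.+1 (fun v => v%:R / 4)
    (fun v => kap @^-1` [set v]) (1 / 4) (fun y => T nu y * T nu y).
  rewrite T1 lee_fin => H.
  have {}H : 1 <= 1 / 4 + \sum_(i < k.+1) i%:R / 4 * fine (eta (kap @^-1` [set i])).
    apply: H => // [|y|y].
    - exact: measurable_funM.
    - by rewrite -expr2 sqr_ge0.
    - rewrite (bigD1 (kap y))//= indicE mem_set//= mulr1.
      have := truncnS_gt (h y); rewrite -addn1 natrD {1}/h expr2 => lt.
      have : 0 <= \sum_(i < k.+1 | i != kap y) i%:R / 4 * \1_(kap @^-1` [set i]) y :> R.
        by apply: sumr_ge0 => i _; rewrite mulr_ge0// indicE.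
      lra.
  rewrite ler_pdivrMr// /p mulr_suml.
  have -> : \sum_v fine (eta (kap @^-1` [set v])) * a v * k.+1%:R =
      4 * \sum_(i < k.+1) i%:R / 4 * fine (eta (kap @^-1` [set i])).
    rewrite mulr_sumr; apply: eq_bigr => v _.
    by rewrite /a -!mulrA mulVf ?gt_eqF// mulr1; field.
  lra.
have [mS PS] := lower_tail_sample iidY mkap a01 (erefl p).
set S := [set o | _] in mS PS.
exists (~` S); split; first exact: measurableC.
  rewrite probability_setC// EFinB; apply: leeB => //.
  apply: le_trans PS _; rewrite lee_fin -[leRHS]lnK ?posrE// ler_expR.
  rewrite lerNl -lnV ?posrE//.
  (* With [k.+1 <= 5 / 2 * s] the requirement is [m >= 80 / 3 * s * ln gamma^-1], covered by the
     constant 27. *)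
  apply: (@le_trans _ _ (m%:R * (3 / k.+1%:R) / 32)); last first.
    by rewrite ler_pM2r ?invr_gt0// ler_wpM2l.
  rewrite mulrA ler_pdivlMr// ler_pdivlMr//.
  have lg : 0 <= ln gamma^-1 by rewrite ln_ge0// invf_ge1// ltW.
  apply: (@le_trans _ _ (ln gamma^-1 * 32 * (5 / 2 * s))); last by lra.
  by rewrite ler_wpM2l// mulr_ge0.
move=> o oS x.
have one (f : Lam -> R) : \sum_mu f mu = f nu.
  by rewrite (bigD1 nu)//= big1 ?addr0// => mu; rewrite [mu]nuE eqxx.
rewrite !one; under eq_bigr do rewrite one exprMn.
rewrite -mulr_suml.
have lt : m%:R * p / 2 < \sum_i a (kap (Y i o)) by rewrite ltNge; apply/negP.
have le : \sum_i a (kap (Y i o)) <= 4 / k.+1%:R * \sum_i T nu (Y i o) ^+ 2.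
  rewrite mulr_sumr; apply: ler_sum => i _.
  rewrite /a ler_pdivrMr// mulrAC divfK ?gt_eqF//=.
  by rewrite truncn_le.
have : 3 / 8 <= m%:R^-1 * \sum_i T nu (Y i o) ^+ 2.
  rewrite ler_pdivlMl//.
  have : m%:R * (3 / k.+1%:R) / 2 <= 4 / k.+1%:R * \sum_i T nu (Y i o) ^+ 2.
    apply: le_trans (le_trans (ltW lt) le).
    by rewrite ler_pM2r// ler_wpM2l.
  have -> : m%:R * (3 / k.+1%:R) / 2 = (m%:R * (3 / 2)) / k.+1%:R :> R.
    by move: (k.+1%:R^-1) => u; ring.
  rewrite [leRHS]mulrAC ler_pM2r ?invr_gt0//; lra.
have := sqr_ge0 (x nu).
have : 0 <= (w nu * `|x nu|) ^+ 2 / (16 * s) by rewrite divr_ge0 ?sqr_ge0// mulr_ge0// ltW.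
move: (_ / (16 * s)) (x nu ^+ 2) (\sum_i _) (m%:R^-1) => Q X S' mi Q0 X0 hS.
rewrite [mi * (_ * _)]mulrA; move: (mi * S') hS => z hz.
have : 0 <= (z - 3 / 8) * X by rewrite mulr_ge0// subr_ge0.
lra.
Qed.

Lemma good_event (s gamma : R) :
  2 * (\big[Num.max/0]_nu w nu) ^+ 2 <= s -> 0 < gamma < 1 ->
  2 * 1024 ^+ 3 * s * Num.max (ln s ^+ 3 * ln (#|Lam|%:R)) (ln gamma^-1) <= m%:R ->
  exists E : set Om, [/\ measurable E, ((1 - gamma)%:E <= P E)%E &
    forall o, E o -> lower_isometry T w Y s o].
Proof.
move=> ws g01 hm; have /andP[g0 g1] := g01.
have wb nu : 2 * w nu ^+ 2 <= s.
  apply: le_trans ws; rewrite ler_pM2l// lerXn2r ?nnegrE//.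
  - exact: le_trans (weight_ge1 onT Tw nu).
  - exact: bigmax_ge_id.
  - exact: le_bigmax.
(* With an empty index set the maximum of the weights defaults to 0 and [s] may vanish; every sum
   over indices is then 0 and all samples are good. *)
case: (pickP (@predT Lam)) => [nu _|L0]; last first.
  exists setT; split => //.
    rewrite (@probability_setT _ _ _ P) lee_fin; lra.
  move=> o _ x; rewrite big_pred0//; apply: addr_ge0.
    by rewrite !mulr_ge0 ?invr_ge0// sumr_ge0// => i _; rewrite sqr_ge0.
  rewrite divr_ge0 ?sqr_ge0// mulr_ge0//; apply: le_trans ws.
  by rewrite mulr_ge0// sqr_ge0.
have w1 : 1 <= w nu := weight_ge1 onT Tw nu.
have s2 : 2 <= s.
  have : 1 <= w nu ^+ 2 by rewrite expr_ge1// (le_trans _ w1).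
  have := wb nu; lra.
have lg : 0 < ln gamma^-1 by rewrite ln_gt0// invf_gt1.
have hm1 : 27 * s * ln gamma^-1 <= m%:R.
  apply: le_trans hm; apply: ler_pM.
  - by rewrite mulr_ge0//; lra.
  - exact: ltW.
  - rewrite ler_pM2r; last by lra.
    rewrite !exprS expr0 mulr1; lra.
  - by rewrite le_max lexx orbT.
have m0 : (0 < m)%N.
  rewrite -(ltr0n R); apply: lt_le_trans hm1.
  by rewrite !mulr_gt0//; lra.
case: (ltnP 1 #|Lam|) => B1; first exact: (good_event_many onT Tw iidY s2 B1 g01 m0 hm).
apply: (@good_event_one s gamma nu) => // x.
exact: (fintype_le1P B1 nu x).
Qed.

End GoodEventSmall.

(** * Recovery in Hilbert spaces *)

Section InnerProduct.
Context {R : realType}.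

(** Cauchy-Schwarz, from the nonnegativity of the sum of [(A * b i - B * a i) ^+ 2] and division by
    [2 * (A * B)]. If [A] or [B] is 0, all corresponding terms vanish. *)
Lemma sum_mul_le (I : finType) (p : pred I) (a b : I -> R) (A B : R) :
  0 <= A -> 0 <= B -> \sum_(i | p i) a i ^+ 2 <= A ^+ 2 ->
  \sum_(i | p i) b i ^+ 2 <= B ^+ 2 -> \sum_(i | p i) a i * b i <= A * B.
Proof.
move=> A0 B0 hA hB.
have zero (c : I -> R) : \sum_(i | p i) c i ^+ 2 <= 0 -> forall i, p i -> c i = 0.
  move=> le i pi; apply/eqP; rewrite -sqrf_eq0.
  have : \sum_(i | p i) c i ^+ 2 == 0 by rewrite eq_le le sumr_ge0// => j _; rewrite sqr_ge0.
  rewrite psumr_eq0 => [/allP/(_ i (mem_index_enum i))|j _]; last exact: sqr_ge0.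
  by rewrite pi.
have [A00|An0] := eqVneq A 0.
  rewrite A00 expr0n/= in hA.
  by rewrite A00 mul0r big1// => i pi; rewrite (zero _ hA i pi) mul0r.
have [B00|Bn0] := eqVneq B 0.
  rewrite B00 expr0n/= in hB.
  by rewrite B00 mulr0 big1// => i pi; rewrite (zero _ hB i pi) mulr0.
have AB : 0 < 2 * (A * B) by rewrite !mulr_gt0// lt_def ?An0 ?Bn0.
have : 0 <= \sum_(i | p i) (A * b i - B * a i) ^+ 2.
  by apply: sumr_ge0 => i _; exact: sqr_ge0.
have -> : \sum_(i | p i) (A * b i - B * a i) ^+ 2 =
   A ^+ 2 * \sum_(i | p i) b i ^+ 2 + B ^+ 2 * \sum_(i | p i) a i ^+ 2 -
   2 * (A * B) * \sum_(i | p i) a i * b i.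
  rewrite !mulr_sumr -big_split -sumrB /=; apply: eq_bigr => i _; ring.
have h1 := ler_wpM2l (sqr_ge0 A) hB.
have h2 := ler_wpM2l (sqr_ge0 B) hA.
move=> h; rewrite -(ler_pM2l AB).
have -> : 2 * (A * B) * (A * B) = A ^+ 2 * B ^+ 2 + B ^+ 2 * A ^+ 2 by ring.
lra.
Qed.

Context (X : normedModType R) (ip : X -> X -> R).
Hypothesis ipP : is_inner_product ip.

Lemma ipC x y : ip x y = ip y x. Proof. by case: ipP. Qed.

Lemma ipxx x : ip x x = `|x| ^+ 2. Proof. by case: ipP. Qed.

Lemma ipDl x y z : ip (x + y) z = ip x z + ip y z.
Proof. by case: ipP => _ lin _; have := lin 1 x y z; rewrite scale1r mul1r. Qed.

Lemma ip0l z : ip 0 z = 0.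
Proof. by apply: (addrI (ip 0 z)); rewrite -ipDl !addr0. Qed.

Lemma ipZl a x z : ip (a *: x) z = a * ip x z.
Proof. by case: ipP => _ lin _; have := lin a x 0 z; rewrite !addr0 ip0l addr0. Qed.

Lemma ip_suml (I : Type) (r : seq I) (p : pred I) (f : I -> X) z :
  ip (\sum_(i <- r | p i) f i) z = \sum_(i <- r | p i) ip (f i) z.
Proof. by apply: (big_morph (ip^~ z)) => [x y|]; [exact: ipDl|exact: ip0l]. Qed.

Lemma ip_sumr (I : Type) (r : seq I) (p : pred I) (f : I -> X) z :
  ip z (\sum_(i <- r | p i) f i) = \sum_(i <- r | p i) ip z (f i).
Proof. by rewrite ipC ip_suml; apply: eq_bigr => i _; rewrite ipC. Qed.

Lemma ipZr a x z : ip z (a *: x) = a * ip z x.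
Proof. by rewrite ipC ipZl ipC. Qed.

(** Induction over a list of indices: the residual of the next vector is either 0 or, once
    normalized, a new orthonormal vector. *)
Lemma gram_schmidt (Lam : finType) (z : Lam -> X) :
  exists n (e : 'I_n -> X), (forall i j, ip (e i) (e j) = (i == j)%:R) /\
    forall nu, z nu = \sum_i ip (z nu) (e i) *: e i.
Proof.
suff H (r : seq Lam) : exists n (e : 'I_n -> X),
    (forall i j, ip (e i) (e j) = (i == j)%:R) /\
    forall nu, nu \in r -> z nu = \sum_i ip (z nu) (e i) *: e i.
  have [n [e [on ex]]] := H (enum Lam).
  by exists n, e; split => // nu; apply: ex; rewrite mem_enum.
elim: r => [|mu r [n [e [on ex]]]].
  by exists 0, (fun=> 0); split => [[]|].
pose v := z mu - \sum_i ip (z mu) (e i) *: e i.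
have vE : z mu = \sum_i ip (z mu) (e i) *: e i + v by rewrite addrC subrK.
have [v0|v0] := eqVneq v 0.
  exists n, e; split => // nu; rewrite inE => /predU1P[->|]; last exact: ex.
  by rewrite [LHS]vE v0 addr0.
have nv : `|v| != 0 by rewrite normr_eq0.
pose u := `|v|^-1 *: v.
have ve j : ip v (e j) = 0.
  apply: (addrI (ip (\sum_i ip (z mu) (e i) *: e i) (e j))).
  rewrite -ipDl -vE addr0 ip_suml (bigD1 j)//= big1 => [|i ij].
    by rewrite ipZl on eqxx mulr1 addr0.
  by rewrite ipZl on (negbTE ij) mulr0.
have ue j : ip u (e j) = 0 by rewrite ipZl ve mulr0.
have uu : ip u u = 1 by rewrite /u ipZl ipZr ipxx expr2 mulKf// mulVf.
pose e' (i : 'I_n.+1) := if unlift ord0 i is Some k then e k else u.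
have e'0 : e' ord0 = u by rewrite /e' unlift_none.
have e'S k : e' (lift ord0 k) = e k by rewrite /e' liftK.
exists n.+1, e'; split.
  move=> i j; case: (unliftP ord0 i) => [i' ->|->]; case: (unliftP ord0 j) => [j' ->|->].
  - by rewrite !e'S on (inj_eq lift_inj).
  - by rewrite e'S e'0 ipC ue.
  - by rewrite e'S e'0 ue.
  - by rewrite e'0 uu eqxx.
have spu (f : 'I_n -> R) : ip (\sum_i f i *: e i) u = 0.
  by rewrite ip_suml big1// => i _; rewrite ipZl ipC ue mulr0.
move=> nu; rewrite inE big_ord_recl e'0 => /predU1P[->|nur].
  have -> : ip (z mu) u *: u = v.
    rewrite {1}vE ipDl spu add0r /u ipZr ipxx expr2 mulKf//.
    by rewrite scalerA mulfV// scale1r.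
  by rewrite [LHS]vE addrC; congr (_ + _); apply: eq_bigr => i _; rewrite e'S.
have -> : ip (z nu) u = 0 by rewrite (ex nu nur) spu.
rewrite scale0r add0r [LHS](ex nu nur).
by apply: eq_bigr => i _; rewrite e'S.
Qed.

(** One family of real coordinate vectors works for all [c] at once, so the sampling rows and the
    single coefficients can be treated together. *)
Lemma gram_coordinates (Lam : finType) (z : Lam -> X) :
  exists n (x : 'I_n -> Lam -> R), forall c : Lam -> R,
    `|\sum_nu c nu *: z nu| ^+ 2 = \sum_k (\sum_nu c nu * x k nu) ^+ 2.
Proof.
have [n [e [on ex]]] := gram_schmidt z.
exists n, (fun k nu => ip (z nu) (e k)) => c.
have -> : \sum_nu c nu *: z nu = \sum_k (\sum_nu c nu * ip (z nu) (e k)) *: e k.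
  under [RHS]eq_bigr do rewrite scaler_suml.
  rewrite exchange_big/=; apply: eq_bigr => nu _.
  rewrite {1}(ex nu) scaler_sumr; by apply: eq_bigr => k _; rewrite scalerA.
rewrite -ipxx ip_suml; apply: eq_bigr => k _.
rewrite ipZl ip_sumr (bigD1 k)//= [X in _ + X]big1 => [|j jk].
  by rewrite ipZr on eqxx mulr1 addr0 expr2.
by rewrite ipZr on eq_sym (negbTE jk) mulr0.
Qed.

(* A quadratic lower bound with an l1 penalty passes from scalars to X by
   summing over coordinates; for the penalty this is Minkowski's inequality. *)
Lemma hilbert_lift (Lam : finType) m (A : 'I_m -> Lam -> R) (w : Lam -> R) (K q : R) :
  (forall nu, 0 <= w nu) -> 0 <= q ->
  (forall x : Lam -> R, \sum_nu x nu ^+ 2 <=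
     K * \sum_i (\sum_nu A i nu * x nu) ^+ 2 + (\sum_nu w nu * `|x nu|) ^+ 2 * q) ->
  forall z : Lam -> X, \sum_nu `|z nu| ^+ 2 <=
     K * \sum_i `|\sum_nu A i nu *: z nu| ^+ 2 + (\sum_nu w nu * `|z nu|) ^+ 2 * q.
Proof.
move=> w0 q0 H z.
have [n [x xE]] := gram_coordinates z.
have zE nu : `|z nu| ^+ 2 = \sum_k x k nu ^+ 2.
  have := xE (fun mu => (mu == nu)%:R).
  rewrite (bigD1 nu)//= big1 => [|mu munu]; last by rewrite (negbTE munu) scale0r.
  rewrite eqxx scale1r addr0 => ->; apply: eq_bigr => k _.
  rewrite (bigD1 nu)//= big1 => [|mu munu]; last by rewrite (negbTE munu) mul0r.
  by rewrite eqxx mul1r addr0.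
under eq_bigr do rewrite zE.
under [X in K * X]eq_bigr do rewrite xE.
rewrite exchange_big/= [X in K * X]exchange_big/=.
apply: le_trans (ler_sum _ (fun k _ => H (x k))) _.
rewrite big_split/= -mulr_sumr lerD2l -mulr_suml ler_wpM2r//.
(* Minkowski's inequality in squared form: both sides become double sums over [nu] and [mu],
   compared entry by entry by Cauchy-Schwarz in the coordinate [k]. *)
have sq (f : Lam -> R) : (\sum_nu f nu) ^+ 2 = \sum_nu \sum_mu f nu * f mu.
  by rewrite expr2 mulr_suml; apply: eq_bigr => nu _; rewrite mulr_sumr.
rewrite [leLHS](eq_bigr _ (fun k _ => sq (fun nu => w nu * `|x k nu|))).
rewrite [leRHS]sq exchange_big/=; apply: ler_sum => nu _.
rewrite exchange_big/=; apply: ler_sum => mu _.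
have -> : \sum_i w nu * `|x i nu| * (w mu * `|x i mu|) =
   w nu * w mu * \sum_i `|x i nu| * `|x i mu|.
  by rewrite mulr_sumr; apply: eq_bigr => i _; ring.
have -> : w nu * `|z nu| * (w mu * `|z mu|) = w nu * w mu * (`|z nu| * `|z mu|) by ring.
apply: ler_wpM2l; first exact: mulr_ge0.
by apply: sum_mul_le => //; rewrite zE le_eqVlt; apply/orP; left; apply/eqP;
  apply: eq_bigr => k _; rewrite real_normK ?num_real.
Qed.

Lemma sqr_normB_le (u v : X) : `|u - v| ^+ 2 <= 2 * `|u| ^+ 2 + 2 * `|v| ^+ 2.
Proof.
have le := ler_normB u v.
have uv0 : 0 <= `|u| + `|v| by exact: addr_ge0.
apply: le_trans (_ : (`|u| + `|v|) ^+ 2 <= _); first by rewrite lerXn2r ?nnegrE.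
have := sqr_ge0 (`|u| - `|v|); lra.
Qed.

(** On the support of [h], Cauchy-Schwarz and the weighted cardinality bound the error by
    [Num.sqrt s] times its l2 norm. Off the support [F = F - h] and
    [|F - G| <= 2 |F| + (|G| - |F|)]; the last differences sum to at most 0. *)
Lemma cone_bound (Lam : finType) (w : Lam -> R) (s : R) (F G h : Lam -> X) :
  (forall nu, 0 <= w nu) -> 0 <= s -> wcard w h <= s -> wnorm1 w G <= wnorm1 w F ->
  wnorm1 w (fun nu => F nu - G nu) <=
    2 * (Num.sqrt s * norm2 (fun nu => F nu - G nu)) +
    2 * wnorm1 w (fun nu => F nu - h nu).
Proof.
move=> w0 s0 hs GF.
have CS : \sum_(nu | h nu != 0) w nu * `|F nu - G nu| <=
    Num.sqrt s * norm2 (fun nu => F nu - G nu).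
  apply: sum_mul_le; rewrite ?sqrtr_ge0// sqr_sqrtr ?sumr_ge0//.
  by rewrite [leRHS](bigID (fun nu => h nu != 0))/= lerDl sumr_ge0.
have pt nu : w nu * `|F nu - G nu| <=
    2 * (if h nu != 0 then w nu * `|F nu - G nu| else 0) +
    2 * (w nu * `|F nu - h nu|) + (w nu * `|G nu| - w nu * `|F nu|).
  have tri := ler_normB (F nu) (G nu).
  have tri2 := lerB_dist (F nu) (G nu).
  have W := w0 nu.
  have n0 := normr_ge0 (F nu - h nu).
  have p1 : 0 <= w nu * `|F nu - h nu| by exact: mulr_ge0.
  have p2 : 0 <= w nu * (`|F nu| + `|G nu| - `|F nu - G nu|).
    by rewrite mulr_ge0// subr_ge0.
  have p3 : 0 <= w nu * (`|F nu - G nu| - (`|F nu| - `|G nu|)).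
    by rewrite mulr_ge0// subr_ge0.
  case: ifPn => [_|/negPn/eqP h0]; first lra.
  by rewrite h0 subr0; lra.
apply: le_trans (ler_sum _ (fun nu _ => pt nu)) _.
rewrite !big_split/= sumrN -!mulr_sumr -big_mkcond/=.
rewrite /wnorm1 in GF *.
lra.
Qed.

(** With [N], [L] the l2 and weighted l1 errors, [S = Num.sqrt s] and [D] the error of [h], the good
    event gives [N <= 16 eps + L / (4 S)] and the cone bound [L <= 2 S N + 2 D]. Substitution leaves
    [L / 2] on the right, which is absorbed. *)
Lemma recovery (Lam : finType) (w : Lam -> R) (s eps : R) m (A : 'I_m -> Lam -> R)
    (b : 'I_m -> X) (F G : Lam -> X) :
  (forall nu, 0 <= w nu) -> 0 < s -> 0 <= eps ->
  (forall x : Lam -> R, \sum_nu x nu ^+ 2 <=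
    64 * (m%:R^-1 * \sum_i (\sum_nu A i nu * x nu) ^+ 2) +
    (\sum_nu w nu * `|x nu|) ^+ 2 / (16 * s)) ->
  (forall i, `|b i - \sum_nu A i nu *: F nu| <= eps) ->
  wl1_solution w A b eps G ->
  forall h : Lam -> X, wcard w h <= s ->
  wnorm1 w (fun nu => F nu - G nu) <=
    4 * wnorm1 w (fun nu => F nu - h nu) + 64 * Num.sqrt s * eps /\
  norm2 (fun nu => F nu - G nu) <=
    1 / Num.sqrt s * wnorm1 w (fun nu => F nu - h nu) + 32 * eps.
Proof.
move=> w0 s0 e0 H bF [Gf Gmin] h hs.
set z := fun nu => F nu - G nu.
have bF2 : \sum_(i < m) `|\sum_nu A i nu *: F nu - b i| ^+ 2 <= m%:R * eps ^+ 2.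
  have bF1 i : `|\sum_nu A i nu *: F nu - b i| ^+ 2 <= eps ^+ 2.
    by rewrite distrC lerXn2r ?nnegrE.
  apply: le_trans (ler_sum _ (fun i _ => bF1 i)) _.
  by rewrite sumr_const card_ord -[_ *+ m]mulr_natl.
have Ff : feasible A b eps F.
  rewrite /feasible -[X in _ <= _ * X](ger0_norm e0) -sqrtr_sqr -sqrtrM//.
  by rewrite ler_wsqrtr.
have GF := Gmin F Ff.
have Gf2 : \sum_(i < m) `|\sum_nu A i nu *: G nu - b i| ^+ 2 <= m%:R * eps ^+ 2.
  move: Gf; rewrite /feasible -[X in _ <= _ * X](ger0_norm e0) -sqrtr_sqr -sqrtrM//.
  by rewrite ler_psqrt// nnegrE ?mulr_ge0 ?sqr_ge0// sumr_ge0// => i _; rewrite exprn_ge0.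
have Az : \sum_(i < m) `|\sum_nu A i nu *: z nu| ^+ 2 <= 4 * (m%:R * eps ^+ 2).
  have pt i : `|\sum_nu A i nu *: z nu| ^+ 2 <=
     2 * `|\sum_nu A i nu *: F nu - b i| ^+ 2 + 2 * `|\sum_nu A i nu *: G nu - b i| ^+ 2.
    have -> : \sum_nu A i nu *: z nu =
       (\sum_nu A i nu *: F nu - b i) - (\sum_nu A i nu *: G nu - b i).
      rewrite opprB addrA subrK -sumrB; apply: eq_bigr => nu _; exact: scalerBr.
    exact: sqr_normB_le.
  apply: le_trans (ler_sum _ (fun i _ => pt i)) _.
  rewrite big_split/= -!mulr_sumr; lra.
have mAz : m%:R^-1 * \sum_(i < m) `|\sum_nu A i nu *: z nu| ^+ 2 <= 4 * eps ^+ 2.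
  (* For [m = 0] the inverse is 0 by convention, and the bound is trivial. *)
  have [->|mn0] := eqVneq m%:R (0 : R).
    by rewrite invr0 mul0r mulr_ge0// sqr_ge0.
  rewrite ler_pdivrMl; last by rewrite lt_def mn0/=.
  by rewrite mulrCA.
set N := norm2 z; set L := wnorm1 w z; set S := Num.sqrt s.
have S0 : 0 < S by rewrite sqrtr_gt0.
have SS : S ^+ 2 = s by rewrite sqr_sqrtr// ltW.
have N0 : 0 <= N by exact: sqrtr_ge0.
have L0 : 0 <= L by apply: sumr_ge0 => nu _; rewrite mulr_ge0.
have NL2 : N ^+ 2 <= 256 * eps ^+ 2 + L ^+ 2 / (16 * s).
  rewrite sqr_sqrtr; last by apply: sumr_ge0 => nu _; rewrite exprn_ge0.
  have q0 : 0 <= (16 * s)^-1 by rewrite invr_ge0 mulr_ge0// ltW.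
  apply: le_trans (hilbert_lift (K := 64 * m%:R^-1) (A := A) w0 q0 _ z) _.
    by move=> x; rewrite -mulrA; exact: H.
  rewrite -mulrA lerD2r; lra.
have NL : N <= 16 * eps + L / (4 * S).
  have r0 : 0 <= 16 * eps + L / (4 * S).
    have S4 : 0 <= 4 * S by rewrite mulr_ge0// ltW.
    by rewrite addr_ge0 ?divr_ge0// mulr_ge0.
  rewrite -(@ler_pXn2r _ 2)// ?nnegrE//; apply: (le_trans NL2).
  have -> : (16 * eps + L / (4 * S)) ^+ 2 =
      256 * eps ^+ 2 + L ^+ 2 / (16 * S ^+ 2) + 8 * eps * (L / S).
    by field; rewrite gt_eqF.
  rewrite SS lerDl !mulr_ge0// ?invr_ge0// ltW//.
set D := wnorm1 w (fun nu => F nu - h nu).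
have CB : L <= 2 * (S * N) + 2 * D by exact: cone_bound (ltW s0) hs GF.
have SN : S * N <= 16 * S * eps + L / 4.
  have := ler_wpM2l (ltW S0) NL.
  have -> : S * (16 * eps + L / (4 * S)) = 16 * S * eps + L / 4.
    by field; rewrite gt_eqF.
  by [].
have LD : L <= 4 * D + 64 * S * eps by lra.
split => //; apply: (le_trans NL).
have -> : 1 / S * D + 32 * eps = 16 * eps + (4 * D + 64 * S * eps) / (4 * S).
  by field; rewrite gt_eqF.
by rewrite lerD2l ler_pM2r// invr_gt0 mulr_gt0.
Qed.

End InnerProduct.

(** * Norms of expansions and the final assembly *)

Section Expansion.
Context {R : realType} (X : normedModType R).
Context dU (U : measurableType dU) (eta : probability U R).
Context (Lam : finType) (T : Lam -> U -> R).

Lemma expansionB (F G : Lam -> X) y :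
  expansion T F y - expansion T G y = expansion T (fun nu => F nu - G nu) y.
Proof. by rewrite -sumrB; apply: eq_bigr => nu _; rewrite scalerBr. Qed.

(** Parseval: the squared norm expands into inner products [ip (z nu) (z mu)], and orthonormality
    keeps only the diagonal. *)
Lemma bochner_L2_expansion (ip : X -> X -> R) (z : Lam -> X) :
  is_inner_product ip -> orthonormal_system eta T ->
  bochner_L2 eta (expansion T z) = norm2 z.
Proof.
move=> ipP onT; rewrite /bochner_L2 /norm2; congr Num.sqrt.
under eq_integral => y _.
  rewrite (_ : `|_| ^+ 2 = \sum_nu \sum_mu T nu y * T mu y * ip (z nu) (z mu)).
    over.
  rewrite -(ipxx ipP) /expansion (ip_suml ipP); apply: eq_bigr => nu _.
  rewrite (ip_sumr ipP); apply: eq_bigr => mu _.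
  by rewrite (ipZl ipP) (ipZr ipP) mulrA.
rewrite (integral_quadratic onT (fun nu mu => ip (z nu) (z mu))) /=.
by apply: eq_bigr => nu _; rewrite (ipxx ipP).
Qed.

Lemma bochner_Linf_expansion (w : Lam -> R) (z : Lam -> X) :
  (forall nu y, `|T nu y| <= w nu) ->
  (bochner_Linf eta (expansion T z) <= (wnorm1 w z)%:E)%E.
Proof.
move=> Tw; apply: ess_sup_ler => y; rewrite lee_fin.
apply: le_trans (ler_norm_sum _ _ _) _; apply: ler_sum => nu _.
by rewrite normrZ ler_wpM2r.
Qed.

End Expansion.

(** The infimum need not be attained, so bounds proved for each [h] pass to it as lower bounds;
    [h = 0] shows that the set is not empty. *)
Lemma le_sigma_best (R : realType) (X : normedModType R) (Lam : finType)
    (w : Lam -> R) (s : R) (F : Lam -> X) (x : R) : 0 <= s ->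
  (forall h : Lam -> X, wcard w h <= s -> x <= wnorm1 w (fun nu => F nu - h nu)) ->
  x <= sigma_best w s F.
Proof.
move=> s0 H; apply: lb_le_inf.
  exists (wnorm1 w (fun nu => F nu - 0)); exists (fun=> 0); split => //.
  by rewrite /wcard big1// => nu; rewrite eqxx.
by move=> _ [h [hs ->]]; exact: H.
Qed.

Theorem mainTheorem11 (R : realType) :
  exists C c d c' d' : R,
  [/\ 0 < C, 0 < c, 0 < d, 0 < c' & 0 < d'] /\
  forall (X : completeNormedModType R) (ip : X -> X -> R),
  is_inner_product ip ->
  forall (dU : measure_display) (U : measurableType dU) (eta : probability U R)
         (Lam : finType) (T : Lam -> U -> R),
  orthonormal_system eta T ->
  forall w : Lam -> R, (forall nu y, `|T nu y| <= w nu) ->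
  forall (s gamma : R) (m : nat),
  2 * (\big[Num.max/0]_(nu : Lam) w nu) ^+ 2 <= s ->
  0 < gamma < 1 ->
  C * s * Num.max (ln s ^+ 3 * ln (#|Lam|%:R)) (ln gamma^-1) <= m%:R ->
  forall (dO : measure_display) (Om : measurableType dO) (P : probability Om R)
         (Y : 'I_m -> Om -> U),
  iid_sample P eta Y ->
  exists E : set Om, measurable E /\ ((1 - gamma)%:E <= P E)%E /\
  forall o, E o ->
  forall (F : Lam -> X) (eps : R) (b : 'I_m -> X),
  0 <= eps ->
  (forall i, `|b i - expansion T F (Y i o)| <= eps) ->
  forall Ft : Lam -> X,
  wl1_solution w (fun i nu => T nu (Y i o)) b eps Ft ->
  [/\ (bochner_Linf eta (fun y => expansion T F y - expansion T Ft y)%R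
         <= (wnorm1 w (fun nu => F nu - Ft nu)%R)%:E)%E,
      wnorm1 w (fun nu => F nu - Ft nu)
         <= c * sigma_best w s F + d * Num.sqrt s * eps,
      bochner_L2 eta (fun y => expansion T F y - expansion T Ft y)
         = norm2 (fun nu => F nu - Ft nu)
    & norm2 (fun nu => F nu - Ft nu)
         <= c' / Num.sqrt s * sigma_best w s F + d' * eps].
Proof.
(* The first constant is that of the union bound, the other four are those of [recovery]. *)
exists (2 * 1024 ^+ 3), 4, 64, 1, 32; split.
  by split; rewrite ?mulr_gt0 ?exprn_gt0 ?ltr0n.
move=> X ip ipP dU U eta Lam T onT w Tw s gamma m ws g01 hm dO Om P Y iidY.
have [E [mE PE EH]] := good_event onT Tw iidY ws g01 hm.
exists E; split => //; split => // o /EH isoo F eps b e0 bF Ft sol.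
have w1 nu : 1 <= w nu := weight_ge1 onT Tw nu.
have w0 nu : 0 <= w nu by apply: le_trans (w1 nu).
have s0 : 0 <= s by apply: le_trans ws; rewrite mulr_ge0// sqr_ge0.
set z := fun nu => F nu - Ft nu.
have zE : (fun y => expansion T F y - expansion T Ft y) = expansion T z.
  by apply: funext => y; rewrite expansionB.
have sig0 : 0 <= sigma_best w s F.
  apply: le_sigma_best => // h _.
  by apply: sumr_ge0 => nu _; rewrite mulr_ge0.
(* [recovery] divides by [Num.sqrt s], and positivity of [s] comes from a weight at least 1. Without
   indices both errors are empty sums. *)
have [L0|sp] : (@predT Lam =1 pred0) \/ 0 < s.
  case: (pickP (@predT Lam)) => [nu _|L0]; [right|by left].
  apply: lt_le_trans ws; rewrite mulr_gt0// exprn_gt0//.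
  exact: lt_le_trans (lt_le_trans ltr01 (w1 nu)) (le_bigmax _ _ nu).
- rewrite zE; split.
  + exact: bochner_Linf_expansion.
  + by rewrite /wnorm1 big_pred0// addr_ge0 ?mulr_ge0 ?sqrtr_ge0//.
  + exact: (bochner_L2_expansion z ipP onT).
  + rewrite /norm2 big_pred0// sqrtr0.
    by rewrite addr_ge0 ?mulr_ge0 ?divr_ge0 ?sqrtr_ge0.
have rec := recovery ipP w0 sp e0 isoo bF sol.
have Sp : 0 < Num.sqrt s by rewrite sqrtr_gt0.
rewrite zE; split.
- exact: bochner_Linf_expansion.
- have : (wnorm1 w z - 64 * Num.sqrt s * eps) / 4 <= sigma_best w s F.
    apply: le_sigma_best => // h /rec[le _]; rewrite ler_pdivrMr//; lra.
  lra.
- exact: (bochner_L2_expansion z ipP onT).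
- have : (norm2 z - 32 * eps) * Num.sqrt s <= sigma_best w s F.
    apply: le_sigma_best => // h /rec[_ le].
    by rewrite -ler_pdivlMr// lerBlDr mulrC -div1r.
  by rewrite -ler_pdivlMr// lerBlDr div1r [_^-1 * _]mulrC.
Qed.
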